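(* Assume the setting below, on the Shishkin mesh $S_N$ (i.e. $\lambda=N$) with mesh parameter $a\ge\min\{3,\max\{1,a_*\}\}$, where $a_*=\beta/(b(0)-\beta)$. Then \[ \|w^N-W^N\|\le C\max\left\{\varepsilon N^{-2}(\ln N)^2,\ \varepsilon N^{-1}+N^{-(a+1)/2}\right\}, \] with $C$ independent of $\varepsilon$ and $N$.
   Context: Let $0<\varepsilon<1$. Let $b,c,f\in C^4[0,1]$, and let $\beta$ be a constant with $b(x)>\beta>0$ and $c(x)\ge0$ on $[0,1]$. Let $u$ be the solution of $-\varepsilon u''-bu'+cu=f$ on $(0,1)$ with $u(0)=u(1)=0$. Let $u_0$ be the solution of $-bu_0'+cu_0=f$ on $(0,1)$ with $u_0(1)=0$ (assumed known exactly). Set $w=u-u_0$; it solves $-\varepsilon w''-bw'+cw=\varepsilon u_0''$, $w(0)=-u_0(0)$, $w(1)=0$. Mesh $S_\lambda$, $\lambda\in\{N,\varepsilon^{-1}\}$. $N$ is a positive integer. $Q\in(0,1)$ is a fixed rational with $J=QN$ an integer, and $a>0$. Set $\xi=(a\varepsilon/\beta)\ln\lambda$, assumed $\le Q$, and $h=\xi/J$, $H=(1-\xi)/(N-J)$. The mesh points are $x_i=ih$ ($0\le i\le J$) and $x_i=\xi+(i-J)H$ ($J\le i\le N$). Write $h_i=x_i-x_{i-1}$ and $\hbar_i=(h_i+h_{i+1})/2$. Scheme. $D^+U_i=(U_{i+1}-U_i)/h_{i+1}$, $D^-U_i=(U_i-U_{i-1})/h_i$, $D''U_i=(D^+U_i-D^-U_i)/\hbar_i$.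 Let $\sigma(\rho)=2\rho/(e^{2\rho}-1)$ for $\rho>0$, $\sigma(0)=1$, and $\rho_i=b(x_i)h_{i+1}/(2\varepsilon)$. The ASI operator is $L^NU_i=-\varepsilon\sigma(\rho_i)D''U_i-b(x_i)D^+U_i+c(x_i)U_i$. $W^N$ solves $W^N_0=-u_0(0)$, $L^NW^N_i=\varepsilon u_0''(x_i)$ for $1\le i\le N-1$, $W^N_N=0$. $w^N$ is the restriction of $w$ to the mesh, and $\|U\|=\max_{0\le i\le N}|U_i|$. *)

(* Defs.v *)
From Stdlib Require Import Reals Lra Lia.
From Coquelicot Require Import Coquelicot.
Open Scope R_scope.

Definition I01 (x : R) : Prop := 0 <= x <= 1.

(* g is in C^k[0,1]: there are functions d 0 = g, d 1, ..., d k on [0,1]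
   such that d (j+1) is the (one-sided at the endpoints) derivative of d j
   relative to [0,1], for j < k, and d k is continuous on [0,1]. *)
Definition Ck01 (k : nat) (g : R -> R) : Prop :=
  exists d : nat -> R -> R,
    (forall x, I01 x -> d 0%nat x = g x) /\
    (forall (j : nat) x, (j < k)%nat -> I01 x ->
       filterlim (fun y => (d j y - d j x) / (y - x))
         (within (fun y => I01 y /\ y <> x) (locally x))
         (locally (d (S j) x))) /\
    (forall x, I01 x ->
       filterlim (d k) (within I01 (locally x)) (locally (d k x))).

Definition cont01 (g : R -> R) : Prop :=
  forall x, I01 x -> filterlim g (within I01 (locally x)) (locally (g x)).

(* Shishkin-type mesh S_lambda: transition point xi, J = Q N fine intervals.
   x_i = i h (i <= J), x_i = xi + (i - J) H (J <= i <= N). *)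
Definition mesh (xi : R) (N J : nat) (i : nat) : R :=
  if (i <=? J)%nat then INR i * (xi / INR J)
  else xi + (INR i - INR J) * ((1 - xi) / (INR N - INR J)).

Definition xi_tr (a eps beta lam : R) : R := (a * eps / beta) * ln lam.

Definition hstep (x : nat -> R) (i : nat) : R := x i - x (i - 1)%nat.
Definition hbar (x : nat -> R) (i : nat) : R :=
  (hstep x i + hstep x (S i)) / 2.

Definition Dplus (x : nat -> R) (U : nat -> R) (i : nat) : R :=
  (U (S i) - U i) / hstep x (S i).
Definition Dminus (x : nat -> R) (U : nat -> R) (i : nat) : R :=
  (U i - U (i - 1)%nat) / hstep x i.
Definition D2 (x : nat -> R) (U : nat -> R) (i : nat) : R :=
  (Dplus x U i - Dminus x U i) / hbar x i.

Definition sigma (rho : R) : R :=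
  if Req_EM_T rho 0 then 1 else 2 * rho / (exp (2 * rho) - 1).

Definition LN (eps : R) (b c : R -> R) (x : nat -> R) (U : nat -> R) (i : nat) : R :=
  let rho := b (x i) * hstep x (S i) / (2 * eps) in
  - eps * sigma rho * D2 x U i - b (x i) * Dplus x U i + c (x i) * U i.

(* Main.v *)
Require Import Defs.
From Stdlib Require Import Reals Lra Lia.
From Coquelicot Require Import Coquelicot.
Open Scope R_scope.

(* With [q = exp (- b h / eps)], the scheme on a uniform part of the mesh is
   [- b / (1 - q) (D^+ - q D^-) + c], which is exact for [1], [x] and [exp (- b x / eps)] when [b]
   is frozen at the node.  Hence the truncation error at [x_i] is at most the supremum over
   [0 < t < h] of [psi (x_i + t) + exp (- b t / eps) psi (x_i - t)], where
   [psi z = (c w - eps u0'') (z) - (c w - eps u0'') (x_i) - (b z - b x_i) w' z] is the residual of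
   freezing the coefficients.  With [e (x) = exp (- beta x / eps)], the bounds [w = O (eps + e)],
   [w' = O (eps + e / eps)], [w'' = O (1 + e / eps^2)] give a truncation error
   [O (eps h + (h / eps)^2 e)] on the fine part, where the first-order terms of [psi] cancel,
   [O (eps H + e)] on the coarse part and [O (eps + e (xi) / H)] at the transition point.
   Discrete barriers turn these into an error [O (eps / N + N^-a)], since
   [e (xi) = N^-a] and [(h / eps)^2 = O (1 / N)]; and [N^-a <= N^(-(a+1)/2)] as soon as [1 <= a]. *)

(** * Functions on the unit interval and comparison principles *)

(** Compactness first upgrades b > beta to b >= beta + [mu]. This margin recurs throughout: it
    absorbs c w in the slope estimate, turns exp (- b t / eps) e (x - t) into e (x) times the
    decaying exp (- mu t / eps) even for steps much longer than eps, and makes the discrete operator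
    positive on the discrete layer. The obstacle is that two truncation errors are not small enough
    by themselves: on the fine part (h / eps)^2 e is O (1 / N) without a factor eps, and at the
    transition point the error contains eps without a factor 1 / N. Each is offset by a barrier on
    which the operator is large exactly there: of order e / eps for e itself on the fine part, and
    of order 1 / H at the kink of a function that is constant up to xi and decays afterwards. Hence
    the weights eps / N and eps / N + N^-a suffice. Constants are chosen from bounds on the data and
    on the mesh ratios before eps, N and the solutions are introduced; this gives the uniformity. *)

Definition clamp01 (x : R) : R := Rmax 0 (Rmin 1 x).

Lemma clamp01_in (x : R) : I01 (clamp01 x).
Proof. unfold I01, clamp01, Rmax, Rmin; repeat destruct Rle_dec; lra. Qed.

Lemma clamp01_id (x : R) : I01 x -> clamp01 x = x.
Proof. unfold I01, clamp01, Rmax, Rmin; repeat destruct Rle_dec; lra. Qed.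

Lemma clamp01_lip (x y : R) : Rabs (clamp01 x - clamp01 y) <= Rabs (x - y).
Proof.
  unfold clamp01, Rmax, Rmin, Rabs; repeat destruct Rle_dec; repeat destruct Rcase_abs; lra.
Qed.

(** The extreme value and mean value theorems used below ask for two-sided continuity, also at the
    endpoints. Precomposing with the 1-Lipschitz retraction onto [0,1] supplies it without changing
    values there. *)
Lemma continuity_clamp01 (g : R -> R) (x : R) :
  cont01 g -> continuity_pt (fun y => g (clamp01 y)) x.
Proof.
  intros Hg; apply continuity_pt_filterlim.
  apply filterlim_comp with (2 := Hg (clamp01 x) (clamp01_in x)).
  intros P [e He]; exists e; intros y Hy.
  apply He; [| apply clamp01_in].
  apply Rle_lt_trans with (2 := Hy); apply clamp01_lip.
Qed.

Lemma is_derive_clamp01 (g : R -> R) (x l : R) :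
  0 < x < 1 -> is_derive g x l -> is_derive (fun y => g (clamp01 y)) x l.
Proof.
  intros Hx; apply is_derive_ext_loc.
  assert (Hp : 0 < Rmin x (1 - x)) by (apply Rmin_pos; lra).
  exists (mkposreal _ Hp); intros y Hy.
  assert (Hy' : Rabs (y - x) < Rmin x (1 - x)) by exact Hy.
  pose proof (Rmin_l x (1 - x)); pose proof (Rmin_r x (1 - x)).
  apply Rabs_def2 in Hy'.
  now rewrite clamp01_id; [| unfold I01; lra].
Qed.

Lemma cont01_bounded (g : R -> R) :
  cont01 g -> exists M, 0 < M /\ forall x, I01 x -> Rabs (g x) <= M.
Proof.
  intros Hg.
  destruct (continuity_ab_maj (fun y => Rabs (g (clamp01 y))) 0 1) as [m [Hm _]]; [lra | |].
  { intros z _. apply (continuity_pt_comp (fun y => g (clamp01 y)) Rabs).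
    - now apply continuity_clamp01.
    - apply Rcontinuity_abs. }
  exists (Rabs (g (clamp01 m)) + 1); split.
  - pose proof (Rabs_pos (g (clamp01 m))); lra.
  - intros x Hx; specialize (Hm x Hx); cbv beta in Hm; rewrite (clamp01_id x Hx) in Hm; lra.
Qed.

(** The minimum over the compact interval is attained, so a strict bound leaves a uniform margin.
    Applied to [b] and [beta], it produces [mu]. *)
Lemma cont01_gap (g : R -> R) (k : R) :
  cont01 g -> (forall x, I01 x -> k < g x) ->
  exists mu, 0 < mu /\ forall x, I01 x -> k + mu <= g x.
Proof.
  intros Hg Hk.
  destruct (continuity_ab_min (fun y => g (clamp01 y)) 0 1) as [m [Hm _]]; [lra | |].
  { intros z _; now apply continuity_clamp01. }
  exists (g (clamp01 m) - k); split.
  - specialize (Hk _ (clamp01_in m)); lra.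
  - intros x Hx; specialize (Hm x Hx); cbv beta in Hm; rewrite (clamp01_id x Hx) in Hm; lra.
Qed.

Lemma quotient_limit (g : R -> R) (x l : R) :
  filterlim (fun y => (g y - g x) / (y - x))
    (within (fun y => I01 y /\ y <> x) (locally x)) (locally l) ->
  forall e, 0 < e -> exists d, 0 < d /\
    forall y, I01 y -> y <> x -> Rabs (y - x) < d -> Rabs ((g y - g x) / (y - x) - l) < e.
Proof.
  intros H e He.
  destruct (H (ball l (mkposreal e He)) (locally_ball l (mkposreal e He))) as [d Hd].
  exists d; split; [apply cond_pos |].
  intros y Hy Hyx Hd'; apply (Hd y Hd'); now split.
Qed.

Lemma Ck01_is_derive (g dg : R -> R) (x : R) :
  0 < x < 1 ->
  filterlim (fun y => (g y - g x) / (y - x))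
    (within (fun y => I01 y /\ y <> x) (locally x)) (locally (dg x)) ->
  is_derive g x (dg x).
Proof.
  intros Hx H; apply is_derive_Reals; intros e He.
  destruct (quotient_limit _ _ _ H e He) as [d [Hd Hq]].
  assert (Hp : 0 < Rmin d (Rmin x (1 - x))) by (repeat apply Rmin_pos; lra).
  exists (mkposreal _ Hp); intros h Hh Hhd; cbn in Hhd.
  pose proof (Rmin_l d (Rmin x (1 - x))); pose proof (Rmin_r d (Rmin x (1 - x))).
  pose proof (Rmin_l x (1 - x)); pose proof (Rmin_r x (1 - x)).
  replace h with ((x + h) - x) at 2 by ring.
  apply Hq.
  - apply Rabs_def2 in Hhd; unfold I01; lra.
  - lra.
  - replace (x + h - x) with h by ring; lra.
Qed.

Lemma Ck01_cont01 (g dg : R -> R) :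
  (forall x, I01 x ->
     filterlim (fun y => (g y - g x) / (y - x))
       (within (fun y => I01 y /\ y <> x) (locally x)) (locally (dg x))) ->
  cont01 g.
Proof.
  intros H x Hx P [e He].
  destruct (quotient_limit _ _ _ (H x Hx) 1 Rlt_0_1) as [d [Hd Hq]].
  assert (HK : 0 < Rabs (dg x) + 1) by (pose proof (Rabs_pos (dg x)); lra).
  assert (Hp : 0 < Rmin d (e / (Rabs (dg x) + 1))).
  { apply Rmin_pos; [lra |]. apply Rdiv_lt_0_compat; [apply cond_pos | lra]. }
  exists (mkposreal _ Hp); intros y Hy Hy01; apply He.
  change (Rabs (g y - g x) < e).
  destruct (Req_dec y x) as [-> | Hyx].
  { replace (g x - g x) with 0 by ring; rewrite Rabs_R0; apply cond_pos. }
  assert (Hy' : Rabs (y - x) < Rmin d (e / (Rabs (dg x) + 1))) by exact Hy.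
  assert (Hyd : Rabs (y - x) < d) by (eapply Rlt_le_trans; [exact Hy' | apply Rmin_l]).
  assert (Hye : Rabs (y - x) < e / (Rabs (dg x) + 1))
    by (eapply Rlt_le_trans; [exact Hy' | apply Rmin_r]).
  specialize (Hq y Hy01 Hyx Hyd).
  replace (g y - g x) with ((g y - g x) / (y - x) * (y - x)) by (field; lra).
  rewrite Rabs_mult.
  assert (Hb : Rabs ((g y - g x) / (y - x)) <= Rabs (dg x) + 1).
  { replace ((g y - g x) / (y - x)) with (((g y - g x) / (y - x) - dg x) + dg x) by ring.
    eapply Rle_trans; [apply Rabs_triang | lra]. }
  apply Rle_lt_trans with ((Rabs (dg x) + 1) * Rabs (y - x)).
  - apply Rmult_le_compat_r; [apply Rabs_pos | exact Hb].
  - replace (pos e) with ((Rabs (dg x) + 1) * (e / (Rabs (dg x) + 1))) by (field; lra).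
    now apply Rmult_lt_compat_l.
Qed.

(** A single [M] for a function and its two derivatives lets later constants depend on the data
    through [M] alone. Differentiability is asked only inside, where it is two-sided; the bounds
    hold up to the endpoints. *)
Record C2_bounded (M : R) (g g1 g2 : R -> R) : Prop := {
  C2_der1 : forall x, 0 < x < 1 -> is_derive g x (g1 x);
  C2_der2 : forall x, 0 < x < 1 -> is_derive g1 x (g2 x);
  C2_bound0 : forall x, I01 x -> Rabs (g x) <= M;
  C2_bound1 : forall x, I01 x -> Rabs (g1 x) <= M;
  C2_bound2 : forall x, I01 x -> Rabs (g2 x) <= M }.

Lemma C2_bounded_mono (M M' : R) (g g1 g2 : R -> R) :
  M <= M' -> C2_bounded M g g1 g2 -> C2_bounded M' g g1 g2.
Proof.
  intros HM [H1 H2 H3 H4 H5]; split; auto; intros x Hx;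
    [specialize (H3 x Hx) | specialize (H4 x Hx) | specialize (H5 x Hx)]; lra.
Qed.

Lemma Ck01_C2 (g : R -> R) :
  Ck01 4 g -> cont01 g /\ exists g1 g2 M, 0 < M /\ C2_bounded M g g1 g2.
Proof.
  intros [d [H0 [Hd _]]].
  assert (Hc : forall j, (j < 4)%nat -> cont01 (d j)).
  { intros j Hj; apply Ck01_cont01 with (d (S j)); intros x Hx; now apply Hd. }
  split.
  { intros x Hx; rewrite <- (H0 x Hx).
    apply filterlim_within_ext with (d 0%nat); [| apply Hc; [lia | assumption]].
    intros y Hy; now apply H0. }
  destruct (cont01_bounded _ (Hc 0%nat ltac:(lia))) as [M0 [P0 B0]].
  destruct (cont01_bounded _ (Hc 1%nat ltac:(lia))) as [M1 [P1 B1]].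
  destruct (cont01_bounded _ (Hc 2%nat ltac:(lia))) as [M2 [P2 B2]].
  exists (d 1%nat), (d 2%nat), (M0 + M1 + M2); split; [lra | split].
  - intros x Hx.
    apply is_derive_ext_loc with (d 0%nat).
    + assert (Hp : 0 < Rmin x (1 - x)) by (apply Rmin_pos; lra).
      exists (mkposreal _ Hp); intros y Hy; apply H0.
      assert (Hy' : Rabs (y - x) < Rmin x (1 - x)) by exact Hy.
      pose proof (Rmin_l x (1 - x)); pose proof (Rmin_r x (1 - x)).
      apply Rabs_def2 in Hy'; unfold I01; lra.
    + apply Ck01_is_derive; [exact Hx |]. apply Hd; [lia | unfold I01; lra].
  - intros x Hx; apply Ck01_is_derive; [exact Hx |]. apply Hd; [lia | unfold I01; lra].
  - intros x Hx; rewrite <- H0 by exact Hx; specialize (B0 x Hx); lra.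
  - intros x Hx; specialize (B1 x Hx); lra.
  - intros x Hx; specialize (B2 x Hx); lra.
Qed.

(** * Mean value arguments and comparison principles *)

Lemma is_derive_continuity_pt (f : R -> R) (x l : R) :
  is_derive f x l -> continuity_pt f x.
Proof.
  intros H; apply continuity_pt_filterlim, (ex_derive_continuous (V := R_NormedModule)); now exists l.
Qed.

Lemma mean_value (f df : R -> R) (a b : R) :
  a < b ->
  (forall x, a < x < b -> is_derive f x (df x)) ->
  (forall x, a <= x <= b -> continuity_pt f x) ->
  exists z, a < z < b /\ f b - f a = df z * (b - a).
Proof.
  intros Hab Hd Hc.
  assert (pr1 : forall z, a < z < b -> derivable_pt f z).
  { intros z Hz; exists (df z); apply is_derive_Reals; auto. }
  assert (pr2 : forall z, a < z < b -> derivable_pt id z) by (intros; apply derivable_pt_id).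
  destruct (MVT f id a b pr1 pr2 Hab Hc) as [z [Hz E]].
  { intros; apply derivable_continuous_pt, derivable_pt_id. }
  exists z; split; [exact Hz |].
  assert (E1 : derive_pt f z (pr1 z Hz) = df z)
    by (apply derive_pt_eq_0, is_derive_Reals; auto).
  assert (E2 : derive_pt id z (pr2 z Hz) = 1)
    by (apply derive_pt_eq_0, derivable_pt_lim_id).
  rewrite E1, E2 in E; unfold id in E; lra.
Qed.

Lemma nondecreasing_of_derive (f df : R -> R) (a b : R) :
  a <= b ->
  (forall x, a < x < b -> is_derive f x (df x)) ->
  (forall x, a <= x <= b -> continuity_pt f x) ->
  (forall x, a < x < b -> 0 <= df x) ->
  f a <= f b.
Proof.
  intros [Hab | ->] Hd Hc Hp; [| lra].
  destruct (mean_value f df a b Hab Hd Hc) as [z [Hz E]].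
  specialize (Hp z Hz); nra.
Qed.

Lemma derive_sign_right (f : R -> R) (x l : R) :
  is_derive f x l -> l < 0 ->
  exists d, 0 < d /\ forall y, x < y < x + d -> f y < f x.
Proof.
  intros H Hl; apply is_derive_Reals in H.
  destruct (H (- l / 2) ltac:(lra)) as [d Hd].
  exists d; split; [apply cond_pos |]; intros y Hy.
  specialize (Hd (y - x) ltac:(lra)).
  rewrite Rabs_pos_eq in Hd by lra; specialize (Hd ltac:(lra)).
  replace (x + (y - x)) with y in Hd by ring; apply Rabs_def2 in Hd.
  assert (E : f y - f x = (f y - f x) / (y - x) * (y - x)) by (field; lra).
  assert ((f y - f x) / (y - x) < l / 2) by lra.
  nra.
Qed.

Lemma derive_sign_left (f : R -> R) (x l : R) :
  is_derive f x l -> 0 < l ->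
  exists d, 0 < d /\ forall y, x - d < y < x -> f y < f x.
Proof.
  intros H Hl; apply is_derive_Reals in H.
  destruct (H (l / 2) ltac:(lra)) as [d Hd].
  exists d; split; [apply cond_pos |]; intros y Hy.
  specialize (Hd (y - x) ltac:(lra)).
  rewrite Rabs_left in Hd by lra; specialize (Hd ltac:(lra)).
  replace (x + (y - x)) with y in Hd by ring; apply Rabs_def2 in Hd.
  assert (E : f y - f x = (f y - f x) / (y - x) * (y - x)) by (field; lra).
  assert (l / 2 < (f y - f x) / (y - x)) by lra.
  nra.
Qed.

(** At a negative minimum over [a, x] a positive derivative would produce smaller values just to the
    left. The interval is half-open because [P] will often contain a derivative that is not
    controlled at the right endpoint. *)
Lemma first_order_comparison (P P1 : R -> R) (a b : R) :
  (forall x, a <= x < b -> continuity_pt P x) ->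
  (forall x, a < x < b -> is_derive P x (P1 x)) ->
  0 <= P a ->
  (forall x, a < x < b -> P x < 0 -> 0 < P1 x) ->
  forall x, a <= x < b -> 0 <= P x.
Proof.
  intros Hc Hd Ha H x Hx; destruct (Rle_lt_dec 0 (P x)) as [| Hneg]; [assumption | exfalso].
  destruct (continuity_ab_min P a x) as [m [Hm Hmx]]; [lra | intros; apply Hc; lra |].
  assert (P m <= P x) by (apply Hm; lra).
  assert (m <> a) by (intros ->; lra).
  destruct (derive_sign_left P m (P1 m)) as [d [Hd0 Hlt]].
  - apply Hd; lra.
  - apply H; lra.
  - pose proof (Rmin_l d (m - a)); pose proof (Rmin_r d (m - a)).
    assert (0 < Rmin d (m - a)) by (apply Rmin_pos; lra).
    specialize (Hlt (m - Rmin d (m - a) / 2) ltac:(lra)).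
    specialize (Hm (m - Rmin d (m - a) / 2) ltac:(lra)); lra.
Qed.

(** A negative minimum is interior and critical; there the hypothesis makes [P1] decrease through
    zero, so [P] drops just to the right of its minimum. Only the sign of [P2] at negative critical
    points is asked for, so [P2] may be discontinuous. *)
Lemma second_order_comparison (P P1 P2 : R -> R) :
  (forall x, 0 <= x <= 1 -> continuity_pt P x) ->
  (forall x, 0 < x < 1 -> is_derive P x (P1 x)) ->
  (forall x, 0 < x < 1 -> is_derive P1 x (P2 x)) ->
  0 <= P 0 -> 0 <= P 1 ->
  (forall x, 0 < x < 1 -> P x < 0 -> P1 x = 0 -> P2 x < 0) ->
  forall x, 0 <= x <= 1 -> 0 <= P x.
Proof.
  intros Hc Hd1 Hd2 H0 H1 H x Hx; destruct (Rle_lt_dec 0 (P x)) as [| Hneg]; [assumption | exfalso].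
  destruct (continuity_ab_min P 0 1) as [m [Hm Hmx]]; [lra | assumption |].
  assert (P m <= P x) by (apply Hm; lra).
  assert (m <> 0) by (intros ->; lra).
  assert (m <> 1) by (intros ->; lra).
  assert (Hm01 : 0 < m < 1) by lra.
  assert (HP1 : P1 m = 0).
  { destruct (Rtotal_order (P1 m) 0) as [Hlt | [E | Hgt]]; [| exact E |].
    - destruct (derive_sign_right P m (P1 m) (Hd1 m Hm01) Hlt) as [d [Hd0 Hy]].
      pose proof (Rmin_l d (1 - m)); pose proof (Rmin_r d (1 - m)).
      assert (0 < Rmin d (1 - m)) by (apply Rmin_pos; lra).
      specialize (Hy (m + Rmin d (1 - m) / 2) ltac:(lra)).
      specialize (Hm (m + Rmin d (1 - m) / 2) ltac:(lra)); lra.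
    - destruct (derive_sign_left P m (P1 m) (Hd1 m Hm01) Hgt) as [d [Hd0 Hy]].
      pose proof (Rmin_l d m); pose proof (Rmin_r d m).
      assert (0 < Rmin d m) by (apply Rmin_pos; lra).
      specialize (Hy (m - Rmin d m / 2) ltac:(lra)).
      specialize (Hm (m - Rmin d m / 2) ltac:(lra)); lra. }
  destruct (derive_sign_right P1 m (P2 m) (Hd2 m Hm01)) as [d [Hd0 Hy]].
  { apply H; [assumption | lra | assumption]. }
  pose proof (Rmin_l d (1 - m)); pose proof (Rmin_r d (1 - m)).
  assert (0 < Rmin d (1 - m)) by (apply Rmin_pos; lra).
  destruct (mean_value P P1 m (m + Rmin d (1 - m) / 2)) as [z [Hz E]]; [lra | | |].
  - intros; apply Hd1; lra.
  - intros; apply Hc; lra.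
  - specialize (Hy z ltac:(lra)).
    specialize (Hm (m + Rmin d (1 - m) / 2) ltac:(lra)); nra.
Qed.

(** * The reduced solution *)

Lemma Rabs_add_le (x y X Y : R) : Rabs x <= X -> Rabs y <= Y -> Rabs (x + y) <= X + Y.
Proof. intros; pose proof (Rabs_triang x y); lra. Qed.

Lemma Rabs_sub_le (x y X Y : R) : Rabs x <= X -> Rabs y <= Y -> Rabs (x - y) <= X + Y.
Proof. intros; unfold Rminus; apply Rabs_add_le; [| rewrite Rabs_Ropp]; assumption. Qed.

Lemma Rabs_mul_le (x y X Y : R) : Rabs x <= X -> Rabs y <= Y -> Rabs (x * y) <= X * Y.
Proof. intros; rewrite Rabs_mult; apply Rmult_le_compat; try apply Rabs_pos; assumption. Qed.

Lemma Rabs_div_le (x d X D : R) :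
  0 < D -> D <= d -> Rabs x <= X -> Rabs (x / d) <= X / D.
Proof.
  intros; unfold Rdiv; apply Rabs_mul_le; [assumption |].
  rewrite Rabs_pos_eq; [apply Rinv_le_contravar; lra |].
  left; apply Rinv_0_lt_compat; lra.
Qed.

Lemma Rabs_add3_le (x y z X Y Z : R) :
  Rabs x <= X -> Rabs y <= Y -> Rabs z <= Z -> Rabs (x + y + z) <= X + Y + Z.
Proof. intros; repeat apply Rabs_add_le; assumption. Qed.

Lemma lipschitz_of_derive (f df : R -> R) (K : R) :
  (forall x, 0 < x < 1 -> is_derive f x (df x)) ->
  (forall x, 0 < x < 1 -> Rabs (df x) <= K) ->
  forall x y, 0 < x < 1 -> 0 < y < 1 -> Rabs (f x - f y) <= K * Rabs (x - y).
Proof.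
  intros Hd HK.
  assert (H : forall x y, 0 < x < 1 -> 0 < y < 1 -> x < y -> Rabs (f x - f y) <= K * Rabs (x - y)).
  { intros x y Hx Hy Hxy.
    destruct (mean_value f df x y Hxy) as [z [Hz E]].
    - intros; apply Hd; lra.
    - intros z Hz; apply is_derive_continuity_pt with (df z); apply Hd; lra.
    - rewrite <- (Rabs_Ropp (f x - f y)), <- (Rabs_Ropp (x - y)), !Ropp_minus_distr, E.
      apply Rabs_mul_le; [apply HK; lra | lra]. }
  intros x y Hx Hy; destruct (Rtotal_order x y) as [Hlt | [-> | Hgt]].
  - now apply H.
  - rewrite !Rminus_diag, Rabs_R0; lra.
  - rewrite <- (Rabs_Ropp (f x - f y)), <- (Rabs_Ropp (x - y)), !Ropp_minus_distr; now apply H.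
Qed.

(** Two mean value steps, each costing one factor [r]. The missing 1/2 only affects constants. *)
Lemma second_order_taylor (f f1 f2 : R -> R) (K r x y : R) :
  (forall z, x - r < z < x + r -> is_derive f z (f1 z)) ->
  (forall z, x - r < z < x + r -> is_derive f1 z (f2 z)) ->
  (forall z, x - r < z < x + r -> Rabs (f2 z) <= K) ->
  Rabs (y - x) < r ->
  Rabs (f y - f x - f1 x * (y - x)) <= K * r ^ 2.
Proof.
  intros H1 H2 HK Hy.
  assert (Hyx := Rabs_def2 _ _ Hy).
  assert (K0 : 0 <= K) by (pose proof (Rabs_pos (f2 x)); specialize (HK x ltac:(lra)); lra).
  assert (S1 : forall z, x - r < z < x + r -> Rabs (f1 z - f1 x) <= K * r).
  { intros z Hz; destruct (Rtotal_order z x) as [Hlt | [-> | Hgt]].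
    - destruct (mean_value f1 f2 z x Hlt) as [t [Ht E]].
      + intros; apply H2; lra.
      + intros t Ht; apply is_derive_continuity_pt with (f2 t); apply H2; lra.
      + rewrite <- Rabs_Ropp, Ropp_minus_distr, E; apply Rabs_mul_le.
        * apply HK; lra.
        * rewrite Rabs_pos_eq; lra.
    - rewrite Rminus_diag, Rabs_R0; nra.
    - destruct (mean_value f1 f2 x z Hgt) as [t [Ht E]].
      + intros; apply H2; lra.
      + intros t Ht; apply is_derive_continuity_pt with (f2 t); apply H2; lra.
      + rewrite E; apply Rabs_mul_le.
        * apply HK; lra.
        * rewrite Rabs_pos_eq; lra. }
  assert (S2 : exists t, x - r < t < x + r /\ f y - f x = f1 t * (y - x)).
  { destruct (Rtotal_order y x) as [Hlt | [-> | Hgt]].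
    - destruct (mean_value f f1 y x Hlt) as [t [Ht E]].
      + intros; apply H1; lra.
      + intros t Ht; apply is_derive_continuity_pt with (f1 t); apply H1; lra.
      + exists t; split; [lra | nra].
    - exists x; split; [lra | ring].
    - destruct (mean_value f f1 x y Hgt) as [t [Ht E]].
      + intros; apply H1; lra.
      + intros t Ht; apply is_derive_continuity_pt with (f1 t); apply H1; lra.
      + exists t; split; [lra | nra]. }
  destruct S2 as [t [Ht E]]; rewrite E, <- Rmult_minus_distr_r.
  replace (K * r ^ 2) with ((K * r) * r) by ring.
  apply Rabs_mul_le; [now apply S1 | lra].
Qed.

(** The equation itself expresses u0' through [u0] and the data, so each differentiation costs one
    derivative of the data. Two derivatives of [b], [c], [f] thus give three of [u0], and the third
    one yields the Lipschitz bound on [v2]. *)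
Lemma reduced_solution_bounds (beta M : R) :
  0 < beta -> 0 < M ->
  exists K, 0 < K /\ forall b b1 b2 c c1 c2 f f1 f2 u0 : R -> R,
    C2_bounded M b b1 b2 -> C2_bounded M c c1 c2 -> C2_bounded M f f1 f2 ->
    (forall x, I01 x -> beta <= b x) -> (forall x, I01 x -> 0 <= c x) ->
    (forall x, continuity_pt u0 x) -> u0 1 = 0 ->
    (forall x, 0 < x < 1 -> is_derive u0 x ((c x * u0 x - f x) / b x)) ->
    Rabs (u0 0) <= K /\
    exists v2,
      (forall x, 0 < x < 1 -> is_derive (fun y => (c y * u0 y - f y) / b y) x (v2 x)) /\
      (forall x, 0 < x < 1 -> Rabs (v2 x) <= K) /\
      (forall x y, 0 < x < 1 -> 0 < y < 1 -> Rabs (v2 x - v2 y) <= K * Rabs (x - y)).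
Proof.
  intros Hbeta HM.
  (* [U] is the slope of a linear barrier: b U >= M + 1 exceeds |f|. [V1], [V2], [V3] are the
     term-by-term bounds of [v1], [v2], [v3] defined below. *)
  set (U := (M + 1) / beta).
  set (V1 := (M * U + M) / beta).
  set (V2 := (M * U + M * V1 + M + M * V1) / beta).
  set (V3 := (M * U + M * V1 + (M * V1 + M * V2) + M + (M * V1 + M * V2) + M * V2) / beta).
  assert (HU : 0 < U) by (apply Rdiv_lt_0_compat; lra).
  assert (HV1 : 0 < V1) by (apply Rdiv_lt_0_compat; nra).
  assert (HV2 : 0 < V2) by (apply Rdiv_lt_0_compat; nra).
  assert (HV3 : 0 < V3) by (apply Rdiv_lt_0_compat; nra).
  exists (U + V2 + V3); split; [lra |].
  intros b b1 b2 c c1 c2 f f1 f2 u0 Hb Hc Hf Hblo Hclo Hcont Hu1 Hder.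
  (* With y = 1 - x the condition u0 (1) = 0 becomes an initial condition, and [s] treats both signs
     at once. *)
  assert (Bd : forall s, Rabs s = 1 -> forall y, 0 <= y < 1 -> 0 <= U * y + s * u0 (1 - y)).
  { intros s Hs.
    assert (Hs' : s = 1 \/ s = -1)
      by (revert Hs; unfold Rabs; destruct Rcase_abs; intros; [right | left]; lra).
    apply (first_order_comparison _
      (fun y => U - s * ((c (1 - y) * u0 (1 - y) - f (1 - y)) / b (1 - y)))).
    - intros y _; apply continuity_pt_plus.
      + apply continuity_pt_mult; [apply continuity_pt_const; now intros ? ? |
          apply derivable_continuous_pt, derivable_pt_id].
      + apply continuity_pt_mult; [apply continuity_pt_const; now intros ? ? |].
        apply (continuity_pt_comp (fun y => 1 - y) u0); [| apply Hcont].
        apply continuity_pt_minus; [apply continuity_pt_const; now intros ? ? |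
          apply derivable_continuous_pt, derivable_pt_id].
    - intros y Hy; specialize (Hder (1 - y) ltac:(lra)).
      assert (Ha : is_derive (fun y => u0 (1 - y)) y (-1 * ((c (1 - y) * u0 (1 - y) - f (1 - y)) / b (1 - y)))).
      { apply (is_derive_comp u0 (fun y => 1 - y)); [exact Hder |]. auto_derive; [exact I | ring]. }
      evar_last.
      { apply (is_derive_plus (V := R_NormedModule)).
        - apply is_derive_scal, is_derive_id.
        - apply is_derive_scal, Ha. }
      cbn; unfold plus; cbn; field.
      specialize (Hblo (1 - y) ltac:(unfold I01; lra)); lra.
    - replace (1 - 0) with 1 by ring; rewrite Hu1; lra.
    - intros y Hy Hneg.
      assert (HI : I01 (1 - y)) by (unfold I01; lra).
      specialize (Hblo _ HI); specialize (Hclo _ HI).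
      pose proof (C2_bound0 _ _ _ _ Hf _ HI) as Bf; apply Rabs_le_between in Bf.
      set (bb := b (1 - y)) in *; set (cc := c (1 - y)) in *.
      set (uu := u0 (1 - y)) in *; set (ff := f (1 - y)) in *.
      replace (U - s * ((cc * uu - ff) / bb)) with ((U * bb - cc * (s * uu) + s * ff) / bb)
        by (field; lra).
      apply Rdiv_lt_0_compat; [| lra].
      assert (M + 1 <= U * bb).
      { replace (M + 1) with (U * beta) by (unfold U; field; lra). nra. }
      assert (s * uu < 0) by nra.
      assert (0 <= cc * - (s * uu)) by nra.
      destruct Hs' as [-> | ->]; lra. }
  assert (Bu : forall x, 0 < x <= 1 -> Rabs (u0 x) <= U).
  { intros x Hx.
    pose proof (Bd 1 Rabs_R1 (1 - x) ltac:(lra)) as B1.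
    pose proof (Bd (-1) ltac:(rewrite Rabs_left; lra) (1 - x) ltac:(lra)) as B2.
    replace (1 - (1 - x)) with x in * by ring.
    apply Rabs_le; split; nra. }
  (* The comparison stops short of x = 0; the bound passes to the limit by continuity. *)
  assert (Bu0 : Rabs (u0 0) <= U).
  { destruct (Rle_lt_dec (Rabs (u0 0)) U) as [| Hgt]; [assumption | exfalso].
    destruct (Hcont 0 (Rabs (u0 0) - U) ltac:(lra)) as [d [Hd H]].
    pose proof (Rmin_l (d / 2) 1); pose proof (Rmin_r (d / 2) 1).
    assert (0 < Rmin (d / 2) 1) by (apply Rmin_pos; lra).
    specialize (H (Rmin (d / 2) 1)).
    cbn in H; unfold D_x, no_cond, Rdist in H; rewrite Rminus_0_r in H.
    rewrite (Rabs_pos_eq (Rmin (d / 2) 1)) in H by lra.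
    specialize (H ltac:(repeat split; lra)).
    specialize (Bu (Rmin (d / 2) 1) ltac:(lra)).
    pose proof (Rabs_triang_inv (u0 0) (u0 (Rmin (d / 2) 1))).
    rewrite Rabs_minus_sym in H; lra. }
  set (v1 := fun x => (c x * u0 x - f x) / b x).
  set (v2 := fun x => ((c1 x * u0 x + c x * v1 x - f1 x) - b1 x * v1 x) / b x).
  set (v3 := fun x => (c2 x * u0 x + c1 x * v1 x + (c1 x * v1 x + c x * v2 x) - f2 x
                       - (b2 x * v1 x + b1 x * v2 x) - b1 x * v2 x) / b x).
  assert (HI : forall x, 0 < x < 1 -> I01 x) by (intros x Hx; unfold I01; lra).
  assert (Bv1 : forall x, 0 < x < 1 -> Rabs (v1 x) <= V1).
  { intros x Hx; apply Rabs_div_le; [assumption | auto |].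
    apply Rabs_sub_le; [apply Rabs_mul_le |].
    - apply (C2_bound0 _ _ _ _ Hc); auto.
    - apply Bu; lra.
    - apply (C2_bound0 _ _ _ _ Hf); auto. }
  assert (Bv2 : forall x, 0 < x < 1 -> Rabs (v2 x) <= V2).
  { intros x Hx; apply Rabs_div_le; [assumption | auto |].
    repeat first [apply Bv1; assumption | apply Bu; lra | apply Rabs_sub_le | apply Rabs_add_le
      | apply Rabs_mul_le];
      solve [ eapply C2_bound0; eauto | eapply C2_bound1; eauto ]. }
  assert (Bv3 : forall x, 0 < x < 1 -> Rabs (v3 x) <= V3).
  { intros x Hx; apply Rabs_div_le; [assumption | auto |].
    repeat first [apply Bv2; assumption | apply Bv1; assumption | apply Bu; lra
      | apply Rabs_sub_le | apply Rabs_add_le | apply Rabs_mul_le];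
      solve [ eapply C2_bound0; eauto | eapply C2_bound1; eauto | eapply C2_bound2; eauto ]. }
  assert (Dv1 : forall x, 0 < x < 1 -> is_derive v1 x (v2 x)).
  { intros x Hx; specialize (Hblo x (HI x Hx)); unfold v1.
    pose proof (C2_der1 _ _ _ _ Hb x Hx) as Db; pose proof (C2_der1 _ _ _ _ Hc x Hx) as Dc.
    pose proof (C2_der1 _ _ _ _ Hf x Hx) as Df; specialize (Hder x Hx).
    auto_derive.
    - repeat split; try lra; eexists; eassumption.
    - rewrite (is_derive_unique (fun y : R => b y) _ _ Db), (is_derive_unique (fun y : R => c y) _ _ Dc),
        (is_derive_unique (fun y : R => f y) _ _ Df), (is_derive_unique (fun y : R => u0 y) _ _ Hder).
      unfold v2, v1; field; lra. }
  assert (Dv2 : forall x, 0 < x < 1 -> is_derive v2 x (v3 x)).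
  { intros x Hx; specialize (Hblo x (HI x Hx)); unfold v2.
    pose proof (C2_der1 _ _ _ _ Hb x Hx) as Db; pose proof (C2_der1 _ _ _ _ Hc x Hx) as Dc.
    pose proof (C2_der2 _ _ _ _ Hb x Hx) as Db1; pose proof (C2_der2 _ _ _ _ Hc x Hx) as Dc1.
    pose proof (C2_der2 _ _ _ _ Hf x Hx) as Df1; specialize (Hder x Hx).
    specialize (Dv1 x Hx).
    (* Making [v1] opaque lets [auto_derive] treat it as an atom with derivative [v2] instead of
       expanding the quotient. *)
    change (is_derive u0 x (v1 x)) in Hder; clearbody v1.
    auto_derive.
    - repeat split; try lra; eexists; eassumption.
    - rewrite (is_derive_unique (fun y : R => b y) _ _ Db), (is_derive_unique (fun y : R => c y) _ _ Dc),
        (is_derive_unique (fun y : R => b1 y) _ _ Db1), (is_derive_unique (fun y : R => c1 y) _ _ Dc1),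
        (is_derive_unique (fun y : R => f1 y) _ _ Df1), (is_derive_unique (fun y : R => u0 y) _ _ Hder),
        (is_derive_unique (fun y : R => v1 y) _ _ Dv1).
      unfold v3, v2; field; lra. }
  split; [lra |].
  exists v2; split; [exact Dv1 | split].
  - intros x Hx; specialize (Bv2 x Hx); lra.
  - intros x y Hx Hy.
    eapply Rle_trans; [apply (lipschitz_of_derive v2 v3 V3); auto |].
    apply Rmult_le_compat_r; [apply Rabs_pos | lra].
Qed.

(** * A priori bounds for the layer problem *)

(** The problem for w = u - u0, detached from its origin: [g] and [g2] stand for w' and w'', [v2]
    for u0''. Continuity of [w] on the whole line is available because the clamped extension will be
    supplied. *)
Record layer_problem (beta mu M eps : R) (b b1 b2 c c1 c2 w g g2 v2 : R -> R) : Prop := {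
  lp_eps : 0 < eps < 1;
  lp_b : C2_bounded M b b1 b2;
  lp_c : C2_bounded M c c1 c2;
  lp_b_lower : forall x, I01 x -> beta + mu <= b x;
  lp_c_lower : forall x, I01 x -> 0 <= c x;
  lp_cont : forall x, continuity_pt w x;
  lp_w0 : Rabs (w 0) <= M;
  lp_w1 : w 1 = 0;
  lp_der1 : forall x, 0 < x < 1 -> is_derive w x (g x);
  lp_der2 : forall x, 0 < x < 1 -> is_derive g x (g2 x);
  lp_eq : forall x, 0 < x < 1 -> eps * g2 x + b x * g x = c x * w x - eps * v2 x;
  lp_rhs : forall x, 0 < x < 1 -> Rabs (v2 x) <= M;
  lp_rhs_lip : forall x y, 0 < x < 1 -> 0 < y < 1 -> Rabs (v2 x - v2 y) <= M * Rabs (x - y) }.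

Definition layer (beta eps x : R) : R := exp (- (beta * x / eps)).

(** [lb_incr] is [lb_g] integrated: its layer part carries no factor 1 / eps, which the slope bound
    times y - x would keep. *)
Record layer_bounds (beta K eps : R) (w g g2 : R -> R) : Prop := {
  lb_w : forall x, 0 <= x <= 1 -> Rabs (w x) <= K * (eps + layer beta eps x);
  lb_g : forall x, 0 < x < 1 -> Rabs (g x) <= K * (eps + layer beta eps x / eps);
  lb_g2 : forall x, 0 < x < 1 -> Rabs (g2 x) <= K * (1 + layer beta eps x / eps ^ 2);
  lb_incr : forall x y, 0 <= x -> x <= y -> y <= 1 ->
    Rabs (w y - w x) <= K * (eps * (y - x) + layer beta eps x) }.

Lemma layer_pos (beta eps x : R) : 0 < layer beta eps x.
Proof. apply exp_pos. Qed.

Lemma layer_le_1 (beta eps x : R) : 0 < beta -> 0 < eps -> 0 <= x -> layer beta eps x <= 1.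
Proof.
  intros; unfold layer; rewrite <- exp_0.
  assert (Hs : 0 <= beta * x / eps).
  { apply Rmult_le_pos; [nra | left; now apply Rinv_0_lt_compat]. }
  destruct Hs as [Hs | <-]; [left; apply exp_increasing; lra | rewrite Ropp_0; lra].
Qed.

Lemma layer_add (beta eps x t : R) :
  layer beta eps (x + t) = layer beta eps x * exp (- (beta * t / eps)).
Proof. unfold layer; rewrite <- exp_plus; f_equal; unfold Rdiv; ring. Qed.

Lemma is_derive_layer (beta eps x : R) :
  0 < eps -> is_derive (layer beta eps) x (- (beta / eps) * layer beta eps x).
Proof. intros; unfold layer, Rdiv; auto_derive; [exact I | ring]. Qed.

Lemma Rabs_le_signs (x K : R) : (forall s, s = 1 \/ s = -1 -> s * x <= K) -> Rabs x <= K.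
Proof.
  intros H; pose proof (H 1 (or_introl eq_refl)); pose proof (H (-1) (or_intror eq_refl)).
  apply Rabs_le; lra.
Qed.

Lemma sign_mul_bounds (s x K : R) : s = 1 \/ s = -1 -> Rabs x <= K -> - K <= s * x <= K.
Proof. intros [-> | ->] H; apply Rabs_le_between in H; lra. Qed.

(** The barrier is A eps (1 - x) + M e. Its linear part beats the right-hand side because A beta = M
    + 1; its layer part covers |w 0| <= M and has the right sign under the operator since b >
    beta. *)
Lemma layer_problem_value_bound (beta mu M eps : R) (b b1 b2 c c1 c2 w g g2 v2 : R -> R) :
  0 < beta -> 0 < mu -> 0 < M ->
  layer_problem beta mu M eps b b1 b2 c c1 c2 w g g2 v2 ->
  forall x, 0 <= x <= 1 -> Rabs (w x) <= ((M + 1) / beta + M) * (eps + layer beta eps x).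
Proof.
  intros Hbeta Hmu HM [[He0 He1] Hb Hc Hblo Hclo Hcont Hw0 Hw1 Hd1 Hd2 Heq Hv Hvl].
  set (A := (M + 1) / beta).
  assert (HA : 0 < A) by (apply Rdiv_lt_0_compat; lra).
  assert (HAb : A * beta = M + 1) by (unfold A; field; lra).
  clearbody A.
  intros x Hx; apply Rabs_le_signs; intros s0 Hs0.
  (* Replacing the sign by its opposite puts the goal in the form barrier + s w >= 0 expected by the
     comparison principle. *)
  assert (exists s, (s = 1 \/ s = -1) /\ s0 = - s) as [s [Hs ->]]
    by (exists (- s0); split; [destruct Hs0; lra | ring]); clear Hs0.
  enough (0 <= A * (eps * (1 - x)) + M * layer beta eps x + s * w x).
  { pose proof (layer_pos beta eps x).
    assert (0 <= A * (eps * x)) by (apply Rmult_le_pos; nra).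
    assert (0 <= A * layer beta eps x) by nra.
    assert (0 <= M * eps) by nra.
    lra. }
  revert x Hx.
  apply (second_order_comparison _
    (fun x => - (A * eps) + M * (- (beta / eps) * layer beta eps x) + s * g x)
    (fun x => M * (- (beta / eps) * (- (beta / eps) * layer beta eps x)) + s * g2 x)).
  - intros x _; repeat apply continuity_pt_plus; repeat apply continuity_pt_mult;
      try (apply continuity_pt_const; now intros ? ?); try apply Hcont.
    + apply is_derive_continuity_pt with (-1); auto_derive; [exact I | ring].
    + eapply is_derive_continuity_pt, is_derive_layer; lra.
  - intros x Hx.
    pose proof (is_derive_layer beta eps x He0) as De; specialize (Hd1 x Hx).
    auto_derive; [repeat split; eexists; eassumption |].
    rewrite (is_derive_unique (fun y : R => layer beta eps y) _ _ De),
      (is_derive_unique (fun y : R => w y) _ _ Hd1); ring.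
  - intros x Hx.
    pose proof (is_derive_layer beta eps x He0) as De; specialize (Hd2 x Hx).
    auto_derive; [repeat split; eexists; eassumption |].
    rewrite (is_derive_unique (fun y : R => layer beta eps y) _ _ De),
      (is_derive_unique (fun y : R => g y) _ _ Hd2); ring.
  - replace (layer beta eps 0) with 1.
    2: { unfold layer; replace (- (beta * 0 / eps)) with 0 by (field; lra); now rewrite exp_0. }
    pose proof (sign_mul_bounds s (w 0) M Hs Hw0); nra.
  - rewrite Hw1; pose proof (layer_pos beta eps 1); nra.
  - intros x Hx Hneg Hz; cbv beta in Hneg, Hz |- *.
    assert (HI : I01 x) by (unfold I01; lra).
    specialize (Hblo x HI); specialize (Hclo x HI); specialize (Heq x Hx).
    pose proof (sign_mul_bounds s (v2 x) M Hs (Hv x Hx)) as Hvs.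
    pose proof (layer_pos beta eps x) as Hl.
    set (e := layer beta eps x) in *.
    assert (Hp1 : 0 <= A * (eps * (1 - x))) by (repeat apply Rmult_le_pos; lra).
    assert (Hp2 : 0 < M * e) by nra.
    assert (Hsw : s * w x < 0) by (lra).
    assert (Hq : 0 < beta / eps) by (apply Rdiv_lt_0_compat; lra).
    set (q := beta / eps) in *.
    assert (Eq : eps * q = beta) by (unfold q; field; lra).
    assert (Hsg : s * g x = A * eps + M * (q * e)) by lra.
    assert (Hsg2 : eps * (s * g2 x) = c x * (s * w x) - eps * (s * v2 x) - b x * (s * g x))
      by (transitivity (s * (eps * g2 x)); [ring |];
          replace (eps * g2 x) with (c x * w x - eps * v2 x - b x * g x) by lra; ring).
    (* [Hsg] comes from criticality and eliminates w'. The layer terms then combine to - M (q e) (b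
       - beta), those of order eps to at most - eps, and the c w term is nonpositive. *)
    assert (eps * (M * (- q * (- q * e)) + s * g2 x) < 0); [| nra].
    replace (eps * (M * (- q * (- q * e)) + s * g2 x)) with
      (M * q * e * (eps * q) + eps * (s * g2 x)) by ring.
    rewrite Eq, Hsg2, Hsg.
    assert (0 <= c x * - (s * w x)) by nra.
    assert (M + 1 <= b x * A) by nra.
    assert (0 < M * (q * e)) by (apply Rmult_lt_0_compat; [lra | nra]).
    assert (0 < M * (q * e) * (b x - beta)) by nra.
    assert (eps * (M + 1) <= eps * (b x * A)) by nra.
    assert (eps * - M <= eps * (s * v2 x)) by nra.
    nra.
Qed.

(** The mean value theorem on [0, eps] gives one point where eps w' equals the bounded quantity w
    (eps) - w (0); [G] carries the bound to every other point. This crude estimate serves to start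
    the refined one near 0. *)
Lemma layer_problem_slope_bound (beta mu M K0 eps : R) (b b1 b2 c c1 c2 w g g2 v2 : R -> R) :
  0 < beta -> 0 < mu -> 0 < M -> 0 < K0 ->
  layer_problem beta mu M eps b b1 b2 c c1 c2 w g g2 v2 ->
  (forall x, 0 <= x <= 1 -> Rabs (w x) <= K0 * (eps + layer beta eps x)) ->
  forall x, 0 < x < 1 -> Rabs (eps * g x) <= (4 + 8 * M) * K0 + M.
Proof.
  intros Hbeta Hmu HM HK0 [[He0 He1] Hb Hc Hblo Hclo Hcont Hw0 Hw1 Hd1 Hd2 Heq Hv Hvl] HwK.
  assert (Hw : forall x, 0 <= x <= 1 -> Rabs (w x) <= 2 * K0).
  { intros x Hx; specialize (HwK x Hx).
    pose proof (layer_le_1 beta eps x Hbeta He0 ltac:(lra)); nra. }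
  (* [eps w' + b w] has the bounded derivative [(b' + c) w - eps v2]. *)
  set (G := fun x => eps * g x + b x * w x).
  assert (HG : forall x, 0 < x < 1 -> is_derive G x (b1 x * w x + c x * w x - eps * v2 x)).
  { intros x Hx; unfold G.
    pose proof (C2_der1 _ _ _ _ Hb x Hx) as Db; specialize (Hd1 x Hx); specialize (Hd2 x Hx).
    auto_derive; [repeat split; eexists; eassumption |].
    rewrite (is_derive_unique (fun y : R => g y) _ _ Hd2),
      (is_derive_unique (fun y : R => b y) _ _ Db), (is_derive_unique (fun y : R => w y) _ _ Hd1).
    specialize (Heq x Hx); lra. }
  destruct (mean_value w g 0 eps He0) as [z [Hz E]].
  { intros; apply Hd1; lra. }
  { intros; apply Hcont. }
  intros x Hx.
  assert (HL : Rabs (G x - G z) <= (M * (2 * K0) + M * (2 * K0) + 1 * M) * Rabs (x - z)).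
  { apply (lipschitz_of_derive _ _ _ HG); [| lra | lra].
    intros y Hy; assert (HI : I01 y) by (unfold I01; lra).
    apply Rabs_sub_le; [apply Rabs_add_le; apply Rabs_mul_le | apply Rabs_mul_le].
    - now apply (C2_bound1 _ _ _ _ Hb).
    - apply Hw; lra.
    - now apply (C2_bound0 _ _ _ _ Hc).
    - apply Hw; lra.
    - rewrite Rabs_pos_eq; lra.
    - auto. }
  assert (Hxz : Rabs (x - z) <= 1) by (apply Rabs_le; lra).
  assert (HL' : Rabs (G x - G z) <= M * (4 * K0) + M).
  { assert (0 < M * K0) by nra.
    pose proof (Rmult_le_compat_l (M * (2 * K0) + M * (2 * K0) + 1 * M) _ _ ltac:(lra) Hxz); lra. }
  assert (Ez : eps * g z = w eps - w 0) by lra.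
  assert (Hgz : Rabs (eps * g z) <= 2 * K0 + 2 * K0)
    by (rewrite Ez; apply Rabs_sub_le; apply Hw; lra).
  assert (Hbw : forall y, 0 < y < 1 -> Rabs (b y * w y) <= M * (2 * K0)).
  { intros y Hy; apply Rabs_mul_le; [apply (C2_bound0 _ _ _ _ Hb); unfold I01; lra | apply Hw; lra]. }
  replace (eps * g x) with (G x - G z + eps * g z + (b z * w z - b x * w x)) by (unfold G; ring).
  eapply Rle_trans; [apply Rabs_add3_le; [exact HL' | exact Hgz |]|].
  - apply Rabs_sub_le; apply Hbw; lra.
  - lra.
Qed.

(** Once [w] is bounded, the equation is a first-order one for w', to be compared with A1 eps + A2 e
    / eps. Solving it for w'' and integrating w' give the other two bounds. *)
Lemma layer_problem_bounds (beta mu M : R) :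
  0 < beta -> 0 < mu -> 0 < M ->
  exists K, 0 < K /\ forall eps (b b1 b2 c c1 c2 w g g2 v2 : R -> R),
    layer_problem beta mu M eps b b1 b2 c c1 c2 w g g2 v2 ->
    layer_bounds beta K eps w g g2.
Proof.
  intros Hbeta Hmu HM.
  set (K0 := (M + 1) / beta + M).
  assert (HK0 : 0 < K0).
  { assert (0 < (M + 1) / beta) by (apply Rdiv_lt_0_compat; lra); unfold K0; lra. }
  set (K1 := (4 + 8 * M) * K0 + M).
  assert (HK1 : 0 < K1) by (unfold K1; nra).
  (* Dominates the terms of order eps: [M * K0] from c w and [M] from the right-hand side. *)
  set (A1 := (M * K0 + M) / beta).
  assert (HA1 : 0 < A1) by (apply Rdiv_lt_0_compat; nra).
  assert (HA1b : A1 * beta = M * K0 + M) by (unfold A1; field; lra).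
  pose proof (exp_pos beta) as Heb.
  assert (HMK : 0 < M * K0 / mu) by (apply Rdiv_lt_0_compat; nra).
  (* The first summand gives the starting value on (0, eps]; in the second the margin b - beta >= mu
     absorbs the layer part of c w. *)
  set (A2 := K1 * exp beta + M * K0 / mu).
  assert (HA2 : 0 < A2) by (unfold A2; nra).
  assert (HA2m : M * K0 <= A2 * mu).
  { unfold A2; replace (M * K0) with (M * K0 / mu * mu) at 1 by (field; lra).
    apply Rmult_le_compat_r; nra. }
  set (K2 := A1 + A2).
  assert (HK2 : 0 < K2) by (unfold K2; lra).
  set (K3 := M * K0 + M + M * K2).
  assert (HK3 : 0 < K3) by (unfold K3; nra).
  assert (HK4 : 0 < K2 / beta) by (apply Rdiv_lt_0_compat; lra).
  exists (K0 + K2 + K3 + K2 / beta); split; [lra |].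
  intros eps b b1 b2 c c1 c2 w g g2 v2 LP.
  pose proof (layer_problem_value_bound _ _ _ _ _ _ _ _ _ _ _ _ _ _ Hbeta Hmu HM LP) as HwK.
  fold K0 in HwK.
  pose proof (layer_problem_slope_bound _ _ _ _ _ _ _ _ _ _ _ _ _ _ _ Hbeta Hmu HM HK0 LP HwK) as HgK.
  fold K1 in HgK.
  destruct LP as [[He0 He1] Hb Hc Hblo Hclo Hcont Hw0 Hw1 Hd1 Hd2 Heq Hv Hvl].
  set (e := layer beta eps) in *.
  assert (Hep : forall x, 0 < e x) by (intros; apply layer_pos).
  assert (Hee : forall x, 0 < e x / eps) by (intros; apply Rdiv_lt_0_compat; auto).
  (* For x <= eps the layer is at least exp (- beta), so the crude O (1 / eps) bound already has
     layer form. *)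
  assert (Hg1 : forall x, 0 < x <= eps -> x < 1 -> Rabs (g x) <= A2 * (e x / eps)).
  { intros x Hx Hx1; specialize (HgK x ltac:(lra)).
    rewrite Rabs_mult, (Rabs_pos_eq eps) in HgK by lra.
    assert (1 <= exp beta * e x).
    { unfold e, layer; rewrite <- exp_plus, <- exp_0.
      assert (0 <= beta + - (beta * x / eps)).
      { replace (beta + - (beta * x / eps)) with (beta * (eps - x) / eps) by (field; lra).
        apply Rmult_le_pos; [nra | left; now apply Rinv_0_lt_compat]. }
      pose proof (exp_ineq1_le (beta + - (beta * x / eps))); rewrite exp_0; lra. }
    apply (Rmult_le_reg_l eps); [assumption |].
    replace (eps * (A2 * (e x / eps))) with (A2 * e x) by (field; lra).
    apply Rle_trans with (1 := HgK). unfold A2; specialize (Hep x); nra. }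
  assert (Hg2 : forall x, eps <= x < 1 -> Rabs (g x) <= A1 * eps + A2 * (e x / eps)).
  { intros x Hx; apply Rabs_le_signs; intros s0 Hs0.
    assert (exists s, (s = 1 \/ s = -1) /\ s0 = - s) as [s [Hs ->]]
      by (exists (- s0); split; [destruct Hs0; lra | ring]); clear Hs0.
    enough (0 <= A1 * eps + A2 * (e x / eps) + s * g x) by lra.
    revert x Hx.
    assert (DP : forall x, 0 < x < 1 -> is_derive (fun x => A1 * eps + A2 * (e x / eps) + s * g x) x
      (A2 * (- (beta / eps) * e x / eps) + s * g2 x)).
    { intros x Hx; pose proof (is_derive_layer beta eps x He0) as De; fold e in De; specialize (Hd2 x Hx).
      auto_derive; [repeat split; eexists; eassumption |].
      rewrite (is_derive_unique (fun y : R => e y) _ _ De),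
        (is_derive_unique (fun y : R => g y) _ _ Hd2); field; lra. }
    apply (first_order_comparison _ (fun x => A2 * (- (beta / eps) * e x / eps) + s * g2 x)).
    - intros x Hx; eapply is_derive_continuity_pt, DP; lra.
    - intros x Hx; apply DP; lra.
    - specialize (Hg1 eps ltac:(lra) He1).
      pose proof (sign_mul_bounds s _ _ Hs Hg1); nra.
    - intros x Hx Hneg; cbv beta in Hneg |- *.
      assert (HI : I01 x) by (unfold I01; lra).
      assert (Hx01 : 0 < x < 1) by lra.
      specialize (Hblo x HI); specialize (Heq x Hx01); specialize (HwK x HI).
      pose proof (sign_mul_bounds s (v2 x) M Hs (Hv x Hx01)) as Hvs.
      assert (Bcw : Rabs (c x * w x) <= M * (K0 * (eps + e x)))
        by (apply Rabs_mul_le; [now apply (C2_bound0 _ _ _ _ Hc) | exact HwK]).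
      pose proof (sign_mul_bounds s _ _ Hs Bcw) as Hcw.
      assert (Hsg2 : eps * (s * g2 x) = s * (c x * w x) - eps * (s * v2 x) - b x * (s * g x))
        by (transitivity (s * (eps * g2 x)); [ring |];
            replace (eps * g2 x) with (c x * w x - eps * v2 x - b x * g x) by lra; ring).
      assert (0 < eps * (A2 * (- (beta / eps) * e x / eps) + s * g2 x)); [| nra].
      replace (eps * (A2 * (- (beta / eps) * e x / eps) + s * g2 x))
        with (- (A2 * beta * (e x / eps)) + eps * (s * g2 x)) by (field; lra).
      rewrite Hsg2.
      specialize (Hep x); specialize (Hee x).
      assert (Hle : e x <= e x / eps).
      { apply (Rmult_le_reg_r eps); [assumption |].
        replace (e x / eps * eps) with (e x) by (field; lra); nra. }
      set (d := e x / eps) in *.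
      assert (b x * (A1 * eps + A2 * d) < b x * - (s * g x)) by (apply Rmult_lt_compat_l; lra).
      assert (beta * (A1 * eps) <= b x * (A1 * eps)) by (apply Rmult_le_compat_r; nra).
      assert ((beta + mu) * (A2 * d) <= b x * (A2 * d)) by (apply Rmult_le_compat_r; nra).
      assert (M * K0 * e x <= A2 * mu * d).
      { apply Rle_trans with (M * K0 * d); [apply Rmult_le_compat_l; nra | apply Rmult_le_compat_r; lra]. }
      assert (eps * (s * v2 x) <= eps * M) by nra.
      assert (beta * (A1 * eps) = (M * K0 + M) * eps) by (rewrite <- HA1b; ring).
      nra. }
  assert (HgB : forall x, 0 < x < 1 -> Rabs (g x) <= K2 * (eps + e x / eps)).
  { intros x Hx; specialize (Hee x); unfold K2.
    destruct (Rle_lt_dec x eps).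
    - specialize (Hg1 x ltac:(lra) ltac:(lra)); nra.
    - specialize (Hg2 x ltac:(lra)); nra. }
  split.
  - intros x Hx; specialize (Hep x); apply Rle_trans with (1 := HwK x Hx).
    apply Rmult_le_compat_r; fold e; lra.
  - intros x Hx; specialize (Hee x); apply Rle_trans with (1 := HgB x Hx).
    apply Rmult_le_compat_r; fold e; lra.
  (* The equation bounds eps w''. With every layer term written through d = e / eps^2, dividing by
     eps leaves 1 + d. *)
  - intros x Hx; fold e.
    assert (HI : I01 x) by (unfold I01; lra).
    assert (Hd : 0 < e x / eps ^ 2) by (apply Rdiv_lt_0_compat; [auto | apply pow_lt; lra]).
    assert (He : Rabs (eps * g2 x) <= M * (K0 * (eps + e x)) + eps * M + M * (K2 * (eps + e x / eps))).
    { replace (eps * g2 x) with (c x * w x - eps * v2 x - b x * g x) by (specialize (Heq x Hx); lra).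
      repeat apply Rabs_sub_le; apply Rabs_mul_le; auto.
      - now apply (C2_bound0 _ _ _ _ Hc).
      - rewrite Rabs_pos_eq; lra.
      - now apply (C2_bound0 _ _ _ _ Hb). }
    rewrite Rabs_mult, (Rabs_pos_eq eps) in He by lra.
    assert (E1 : e x = eps * (eps * (e x / eps ^ 2))) by (field; lra).
    assert (E2 : e x / eps = eps * (e x / eps ^ 2)) by (field; lra).
    rewrite E2 in He; rewrite E1 in He at 1.
    set (d := e x / eps ^ 2) in *; clearbody d; clear E1 E2.
    assert (Hed : 0 < eps * d) by (apply Rmult_lt_0_compat; lra).
    assert (eps * (eps * d) <= eps * d) by nra.
    assert (Rabs (g2 x) <= K3 * (1 + d)).
    { apply (Rmult_le_reg_l eps); [assumption |].
      apply Rle_trans with (1 := He).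
      assert (M * K0 * (eps * (eps * d)) <= M * K0 * (eps * d)) by (apply Rmult_le_compat_l; nra).
      assert (0 < M * (eps * d)) by nra.
      unfold K3; nra. }
    apply Rle_trans with (K3 * (1 + d)); [assumption | apply Rmult_le_compat_r; lra].
  - intros x y Hx0 Hxy Hy1; fold e; apply Rabs_le_signs; intros s0 Hs0.
    assert (exists s, (s = 1 \/ s = -1) /\ s0 = - s) as [s [Hs ->]]
      by (exists (- s0); split; [destruct Hs0; lra | ring]); clear Hs0.
    (* [K2 * (eps * t - e t / beta)] is a primitive of the bound in [HgB], so adding or subtracting
       [w] gives a nondecreasing function. *)
    assert (DS : forall t, 0 < t < 1 ->
      is_derive (fun t => K2 * (eps * t - e t / beta) + s * w t) t
        (K2 * (eps + e t / eps) + s * g t)).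
    { intros t Ht; pose proof (is_derive_layer beta eps t He0) as De; fold e in De; specialize (Hd1 t Ht).
      auto_derive; [repeat split; eexists; eassumption |].
      rewrite (is_derive_unique (fun y : R => e y) _ _ De),
        (is_derive_unique (fun y : R => w y) _ _ Hd1); field; lra. }
    assert (HS : K2 * (eps * x - e x / beta) + s * w x <= K2 * (eps * y - e y / beta) + s * w y).
    { apply (nondecreasing_of_derive (fun t => K2 * (eps * t - e t / beta) + s * w t)
        (fun t => K2 * (eps + e t / eps) + s * g t)); [assumption | | |].
      - intros; apply DS; lra.
      - intros t _; apply continuity_pt_plus; apply continuity_pt_mult;
          try (apply continuity_pt_const; now intros ? ?); try apply Hcont.
        apply continuity_pt_minus.
        + apply is_derive_continuity_pt with eps; auto_derive; [exact I | ring].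
        + apply continuity_pt_mult; [| apply continuity_pt_const; now intros ? ?].
          eapply is_derive_continuity_pt, is_derive_layer; lra.
      - intros t Ht; specialize (HgB t ltac:(lra)).
        pose proof (sign_mul_bounds s _ _ Hs HgB); lra. }
    pose proof (Hep x); pose proof (Hep y).
    assert (0 < e y / beta) by (apply Rdiv_lt_0_compat; lra).
    assert (E : K2 * (e x / beta) = K2 / beta * e x) by (field; lra).
    assert (0 <= eps * (y - x)) by nra.
    assert (0 <= K2 * (e y / beta)) by nra.
    assert (- s * (w y - w x) <= K2 * (eps * (y - x)) + K2 / beta * e x) by nra.
    assert (0 <= (K0 + K3 + K2 / beta) * (eps * (y - x))) by (apply Rmult_le_pos; lra).
    assert (0 <= (K0 + K2 + K3) * e x) by (apply Rmult_le_pos; lra).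
    lra.
Qed.

(** * Truncation error on uniform parts of the mesh *)

Lemma exp_neg_le_1 (s : R) : 0 <= s -> exp (- s) <= 1.
Proof.
  intros [Hs | <-]; [left; rewrite <- exp_0; apply exp_increasing; lra |].
  rewrite Ropp_0, exp_0; lra.
Qed.

Lemma exp_neg_mul_le (s : R) : exp (- s) * (1 + s) <= 1.
Proof.
  rewrite exp_Ropp; pose proof (exp_pos s); pose proof (exp_ineq1_le s).
  apply (Rmult_le_reg_l (exp s)); [assumption |].
  replace (exp s * (/ exp s * (1 + s))) with (1 + s) by (field; lra); lra.
Qed.

Lemma exp_le (x y : R) : x <= y -> exp x <= exp y.
Proof. intros [H | ->]; [left; now apply exp_increasing | lra]. Qed.

(* [F t] is the fitted difference with step [t]; it solves [eps F'' + bi F' = rhs] with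
   [F 0 = F' 0 = 0], where [rhs] pairs the residuals at [x + t] and [x - t]. *)
Lemma fitted_difference_bound (w g g2 : R -> R) (eps bi r m x h : R) :
  0 < eps -> 0 < bi -> 0 <= m -> 0 < h ->
  (forall z, continuity_pt w z) ->
  (forall z, x - h < z < x + h -> is_derive w z (g z)) ->
  (forall z, x - h < z < x + h -> is_derive g z (g2 z)) ->
  (forall t, 0 < t < h ->
     Rabs (eps * g2 (x + t) + bi * g (x + t) - r
       + exp (- (bi * t / eps)) * (eps * g2 (x - t) + bi * g (x - t) - r)) <= m) ->
  let q := exp (- (bi * h / eps)) in
  Rabs (w (x + h) - w x - q * (w x - w (x - h)) - r / bi * h * (1 - q)) <= m / bi * h * (1 - q).
Proof.
  intros He Hb Hm Hh Hc Hd1 Hd2 Hr q.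
  set (E := fun t => exp (- (bi * t / eps))).
  assert (DE : forall t, is_derive E t (- (bi / eps) * E t)).
  { intros t; unfold E, Rdiv; auto_derive; [exact I | ring]. }
  assert (E0 : E 0 = 1).
  { unfold E; replace (- (bi * 0 / eps)) with 0 by (field; lra); apply exp_0. }
  set (F := fun t => w (x + t) - w x - E t * (w x - w (x - t)) - r / bi * t * (1 - E t)).
  set (F1 := fun t => g (x + t) + bi / eps * E t * (w x - w (x - t)) - E t * g (x - t)
                      - r / bi * (1 - E t) - r / eps * t * E t).
  set (F2 := fun t => g2 (x + t) - bi / eps * (bi / eps) * E t * (w x - w (x - t))
                      + 2 * (bi / eps) * E t * g (x - t) + E t * g2 (x - t)
                      - 2 * (r / eps) * E t + r / eps * (bi / eps) * t * E t).
  assert (DF : forall t, - h < t < h -> is_derive F t (F1 t)).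
  { intros t Ht; unfold F.
    pose proof (DE t) as De.
    pose proof (Hd1 (x + t) ltac:(lra)) as Dp; pose proof (Hd1 (x + - t) ltac:(lra)) as Dm.
    auto_derive; [repeat split; eexists; eassumption |].
    rewrite (is_derive_unique (fun y : R => E y) _ _ De),
      (is_derive_unique (fun y : R => w y) _ _ Dp), (is_derive_unique (fun y : R => w y) _ _ Dm).
    unfold F1, Rminus; field; lra. }
  assert (DF1 : forall t, - h < t < h -> is_derive F1 t (F2 t)).
  { intros t Ht; unfold F1.
    pose proof (DE t) as De.
    pose proof (Hd1 (x + - t) ltac:(lra)) as Dm.
    pose proof (Hd2 (x + t) ltac:(lra)) as Dgp; pose proof (Hd2 (x + - t) ltac:(lra)) as Dgm.
    auto_derive; [repeat split; eexists; eassumption |].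
    rewrite (is_derive_unique (fun y : R => E y) _ _ De), (is_derive_unique (fun y : R => w y) _ _ Dm),
      (is_derive_unique (fun y : R => g y) _ _ Dgp), (is_derive_unique (fun y : R => g y) _ _ Dgm).
    unfold F2, Rminus; field; lra. }
  assert (ODE : forall t, eps * F2 t + bi * F1 t =
    eps * g2 (x + t) + bi * g (x + t) - r + E t * (eps * g2 (x - t) + bi * g (x - t) - r)).
  { intros t; unfold F1, F2; field; lra. }
  (* m / bi (1 - E t) is the exact solution of eps p' + bi p = m with p 0 = 0, hence the natural
     majorant of F'. *)
  assert (HF1 : forall s, s = 1 \/ s = -1 ->
    forall t, 0 <= t < h -> 0 <= m / bi * (1 - E t) + s * F1 t).
  { intros s Hs.
    assert (DP : forall t, - h < t < h -> is_derive (fun t => m / bi * (1 - E t) + s * F1 t) t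
      (m / eps * E t + s * F2 t)).
    { intros t Ht; pose proof (DE t) as De; specialize (DF1 t Ht); clearbody F1 E.
      auto_derive; [repeat split; eexists; eassumption |].
      rewrite (is_derive_unique (fun y : R => E y) _ _ De),
        (is_derive_unique (fun y : R => F1 y) _ _ DF1); field; lra. }
    apply (first_order_comparison _ (fun t => m / eps * E t + s * F2 t)).
    - intros t Ht; eapply is_derive_continuity_pt, DP; lra.
    - intros t Ht; apply DP; lra.
    - rewrite E0; unfold F1; rewrite E0, Rplus_0_r, Rminus_0_r; right; field; lra.
    - intros t Ht Hneg; cbv beta in Hneg |- *.
      pose proof (sign_mul_bounds s _ _ Hs (Hr t Ht)) as HR.
      change (exp (- (bi * t / eps))) with (E t) in HR; rewrite <- ODE in HR.
      apply (Rmult_lt_reg_l eps); [assumption | rewrite Rmult_0_r].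
      replace (eps * (m / eps * E t + s * F2 t)) with
        (s * (eps * F2 t + bi * F1 t) + m - bi * (m / bi * (1 - E t) + s * F1 t)) by (field; lra).
      set (p := m / bi * (1 - E t) + s * F1 t) in *; clearbody p.
      assert (0 < bi * - p) by (apply Rmult_lt_0_compat; lra).
      lra. }
  assert (Hq : q * (1 + bi * h / eps) <= 1) by apply exp_neg_mul_le.
  (* The integrated majorant is exchanged for one with the factor h (1 - q), which cancels the
     prefactor b / ((1 - q) h) of the scheme. *)
  assert (Hgap : h - eps / bi * (1 - q) <= h * (1 - q)).
  { assert (Ez : bi * h / eps * (eps / bi) = h) by (field; lra).
    assert (H0 : 0 < eps / bi) by (apply Rdiv_lt_0_compat; lra).
    pose proof (Rmult_le_compat_r _ _ _ (Rlt_le _ _ H0) Hq) as H1.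
    replace (q * (1 + bi * h / eps) * (eps / bi)) with
      (q * (eps / bi) + q * (bi * h / eps * (eps / bi))) in H1 by ring.
    rewrite Ez in H1; lra. }
  assert (Hmb : 0 <= m / bi) by (apply Rmult_le_pos; [lra | left; now apply Rinv_0_lt_compat]).
  apply Rle_trans with (m / bi * (h - eps / bi * (1 - q))).
  2: { rewrite Rmult_assoc; now apply Rmult_le_compat_l. }
  change (Rabs (F h) <= m / bi * (h - eps / bi * (1 - E h))).
  apply Rabs_le_signs; intros s0 Hs0.
  assert (exists s, (s = 1 \/ s = -1) /\ s0 = - s) as [s [Hs ->]]
    by (exists (- s0); split; [destruct Hs0; lra | ring]); clear Hs0.
  specialize (HF1 s Hs).
  assert (HS : m / bi * (0 - eps / bi * (1 - E 0)) + s * F 0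
    <= m / bi * (h - eps / bi * (1 - E h)) + s * F h).
  { apply (nondecreasing_of_derive (fun t => m / bi * (t - eps / bi * (1 - E t)) + s * F t)
      (fun t => m / bi * (1 - E t) + s * F1 t)); [lra | | |].
    - intros t Ht; pose proof (DE t) as De; specialize (DF t ltac:(lra)); clearbody F F1 E.
      auto_derive; [repeat split; eexists; eassumption |].
      rewrite (is_derive_unique (fun y : R => E y) _ _ De),
        (is_derive_unique (fun y : R => F y) _ _ DF); field; lra.
    - intros t _.
      assert (CE : continuity_pt E t) by (eapply is_derive_continuity_pt, DE).
      assert (Cid : continuity_pt (fun t => t) t)
        by (apply derivable_continuous_pt, derivable_pt_id).
      assert (Cw1 : continuity_pt (fun t => w (x + t)) t).
      { apply (continuity_pt_comp (fun t => x + t) w); [| apply Hc].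
        apply continuity_pt_plus; [apply continuity_pt_const; now intros ? ? | exact Cid]. }
      assert (Cw2 : continuity_pt (fun t => w (x - t)) t).
      { apply (continuity_pt_comp (fun t => x - t) w); [| apply Hc].
        apply continuity_pt_minus; [apply continuity_pt_const; now intros ? ? | exact Cid]. }
      unfold F; clearbody E.
      repeat first [exact CE | exact Cid | exact Cw1 | exact Cw2
        | apply continuity_pt_const; now intros ? ?
        | apply continuity_pt_minus | apply continuity_pt_plus | apply continuity_pt_mult].
    - intros t Ht; apply HF1; lra. }
  assert (F0 : F 0 = 0) by (unfold F; rewrite E0, Rplus_0_r, Rminus_0_r; ring).
  rewrite E0, F0 in HS; lra.
Qed.

Definition residual (eps : R) (b c w g v2 : R -> R) (x z : R) : R :=
  c z * w z - c x * w x - eps * (v2 z - v2 x) - (b z - b x) * g z.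

Lemma residual_eq (beta mu M eps : R) (b b1 b2 c c1 c2 w g g2 v2 : R -> R) (x z : R) :
  layer_problem beta mu M eps b b1 b2 c c1 c2 w g g2 v2 -> 0 < z < 1 ->
  eps * g2 z + b x * g z - (c x * w x - eps * v2 x) = residual eps b c w g v2 x z.
Proof. intros LP Hz; pose proof (lp_eq _ _ _ _ _ _ _ _ _ _ _ _ _ _ LP z Hz); unfold residual; lra. Qed.

(** Absorbs the factor t / eps produced by w'. It is used with [k] = [beta] to the right of the node
    and with [k] = [mu] to the left. *)
Lemma exp_decay_bounds (eps t k : R) :
  0 < eps -> 0 <= t -> 0 < k ->
  exp (- (k * t / eps)) <= 1 /\ t / eps * exp (- (k * t / eps)) <= / k.
Proof.
  intros He Ht Hk.
  assert (0 <= k * t / eps)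
    by (apply Rmult_le_pos; [nra | left; now apply Rinv_0_lt_compat]).
  split; [now apply exp_neg_le_1 |].
  pose proof (exp_neg_mul_le (k * t / eps)); pose proof (exp_pos (- (k * t / eps))).
  apply (Rmult_le_reg_l k); [assumption |].
  replace (k * (t / eps * exp (- (k * t / eps)))) with (exp (- (k * t / eps)) * (k * t / eps))
    by (field; lra).
  rewrite Rinv_r; lra.
Qed.

(** [Rmin x z] arises because [lb_incr] evaluates the layer at the left endpoint; the last term is
    the Lipschitz bound of [b] times the layer part of w'. *)
Lemma residual_bound (beta mu M K eps : R) (b b1 b2 c c1 c2 w g g2 v2 : R -> R) (x z : R) :
  0 < beta -> 0 < M -> 0 < K ->
  layer_problem beta mu M eps b b1 b2 c c1 c2 w g g2 v2 ->
  layer_bounds beta K eps w g g2 ->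
  0 < x < 1 -> 0 < z < 1 ->
  Rabs (residual eps b c w g v2 x z) <=
    (3 * (M * K) + M) * (eps * Rabs (z - x))
    + M * K * (layer beta eps z + layer beta eps (Rmin x z) + Rabs (z - x) / eps * layer beta eps z).
Proof.
  intros Hbeta HM HK LP LB Hx Hz.
  destruct LP as [[He0 He1] Hb Hc Hblo Hclo Hcont Hw0 Hw1 Hd1 Hd2 Heq Hv Hvl].
  destruct LB as [Bw Bg Bg2 Bi].
  set (e := layer beta eps) in *.
  assert (Ht0 := Rabs_pos (z - x)).
  assert (Ht1 : Rabs (z - x) <= 1) by (apply Rabs_le; lra).
  set (t := Rabs (z - x)) in *.
  assert (Cc : Rabs (c z - c x) <= M * t).
  { apply (lipschitz_of_derive c c1); auto; [apply (C2_der1 _ _ _ _ Hc) |].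
    intros y Hy; apply (C2_bound1 _ _ _ _ Hc); unfold I01; lra. }
  assert (Cb : Rabs (b z - b x) <= M * t).
  { apply (lipschitz_of_derive b b1); auto; [apply (C2_der1 _ _ _ _ Hb) |].
    intros y Hy; apply (C2_bound1 _ _ _ _ Hb); unfold I01; lra. }
  assert (Cw : Rabs (w z - w x) <= K * (eps * t + e (Rmin x z))).
  { destruct (Rle_lt_dec x z) as [H | H].
    - rewrite Rmin_left by lra; unfold t; rewrite (Rabs_pos_eq (z - x)) by lra; apply Bi; lra.
    - rewrite Rmin_right by lra; unfold t.
      rewrite <- Rabs_Ropp, Ropp_minus_distr, <- (Rabs_Ropp (z - x)), Ropp_minus_distr.
      rewrite (Rabs_pos_eq (x - z)) by lra; apply Bi; lra. }
  pose proof (Hvl z x Hz Hx) as Cv; fold t in Cv.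
  specialize (Bw z ltac:(lra)); specialize (Bg z Hz).
  pose proof (C2_bound0 _ _ _ _ Hc x ltac:(unfold I01; lra)) as Mc.
  unfold residual.
  replace (c z * w z - c x * w x) with ((c z - c x) * w z + c x * (w z - w x)) by ring.
  eapply Rle_trans.
  { apply Rabs_sub_le; [apply Rabs_sub_le; [apply Rabs_add_le |] |];
      (eapply Rabs_mul_le; [eassumption || (rewrite Rabs_pos_eq; [apply Rle_refl | lra]) | eassumption]). }
  assert (0 < e z) by apply layer_pos.
  assert (Ed : t * (e z / eps) = t / eps * e z) by (field; lra).
  assert (M * K * (t * e z) <= M * K * e z) by (apply Rmult_le_compat_l; nra).
  fold e. replace (M * t * (K * (eps + e z / eps)))
    with (M * K * (eps * t) + M * K * (t / eps * e z)) by (rewrite <- Ed; ring).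
  lra.
Qed.

(** On the left e (x - t) = e (x) exp (beta t / eps) may be enormous, but its weight exp (- b t /
    eps) leaves e (x) exp (- mu t / eps). The estimate therefore remains valid for steps much longer
    than eps, as on the coarse part. *)
Lemma paired_residual_bound (beta mu M K eps h t : R) (b b1 b2 c c1 c2 w g g2 v2 : R -> R) (x : R) :
  0 < beta -> 0 < mu -> 0 < M -> 0 < K ->
  layer_problem beta mu M eps b b1 b2 c c1 c2 w g g2 v2 ->
  layer_bounds beta K eps w g g2 ->
  0 <= x - h -> x + h <= 1 -> 0 < t < h ->
  Rabs (residual eps b c w g v2 x (x + t)
        + exp (- (b x * t / eps)) * residual eps b c w g v2 x (x - t)) <=
  (6 * (M * K) + 2 * M + M * K * (4 + / beta + / mu)) * (eps * h + layer beta eps x).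
Proof.
  intros Hbeta Hmu HM HK LP LB Hx0 Hx1 Ht.
  pose proof (residual_bound _ _ _ _ _ _ _ _ _ _ _ _ _ _ _ x (x + t) Hbeta HM HK LP LB
    ltac:(lra) ltac:(lra)) as Rp.
  pose proof (residual_bound _ _ _ _ _ _ _ _ _ _ _ _ _ _ _ x (x - t) Hbeta HM HK LP LB
    ltac:(lra) ltac:(lra)) as Rm.
  destruct LP as [[He0 He1] Hb Hc Hblo Hclo Hcont Hw0 Hw1 Hd1 Hd2 Heq Hv Hvl].
  assert (Hbx := Hblo x ltac:(unfold I01; lra)).
  replace (x + t - x) with t in Rp by ring; replace (x - t - x) with (- t) in Rm by ring.
  rewrite Rabs_Ropp, (Rabs_pos_eq t) in Rm by lra; rewrite (Rabs_pos_eq t) in Rp by lra.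
  rewrite Rmin_left in Rp by lra; rewrite Rmin_right in Rm by lra.
  pose proof (layer_pos beta eps x) as Hl.
  destruct (exp_decay_bounds eps t beta He0 ltac:(lra) Hbeta) as [S1 S2].
  destruct (exp_decay_bounds eps t mu He0 ltac:(lra) Hmu) as [S3 S4].
  rewrite layer_add in Rp.
  set (e := layer beta eps x) in *.
  set (p := exp (- (beta * t / eps))) in *.
  set (E := exp (- (b x * t / eps))).
  assert (HE : 0 < E <= 1).
  { split; [apply exp_pos | apply exp_neg_le_1].
    apply Rmult_le_pos; [nra | left; now apply Rinv_0_lt_compat]. }
  assert (HEm : E * layer beta eps (x - t) <= e * exp (- (mu * t / eps))).
  { unfold E, e, layer; rewrite <- !exp_plus; apply exp_le.
    assert (0 <= (b x - beta - mu) * (t / eps)).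
    { apply Rmult_le_pos; [lra | left; apply Rdiv_lt_0_compat; lra]. }
    replace (- (b x * t / eps) + - (beta * (x - t) / eps)) with
      (- (beta * x / eps) + - (mu * t / eps) - (b x - beta - mu) * (t / eps)) by (field; lra).
    lra. }
  set (pm := exp (- (mu * t / eps))) in *.
  assert (Hte : 0 < t / eps) by (apply Rdiv_lt_0_compat; lra).
  assert (HMK : 0 < M * K) by nra.
  assert (Hib : 0 < / beta) by (now apply Rinv_0_lt_compat).
  assert (Him : 0 < / mu) by (now apply Rinv_0_lt_compat).
  assert (B1 : e * p <= e) by nra.
  assert (B2 : t / eps * (e * p) <= / beta * e) by nra.
  assert (B3 : E * layer beta eps (x - t) <= e) by nra.
  assert (B4 : E * (t / eps * layer beta eps (x - t)) <= / mu * e).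
  { apply Rle_trans with (t / eps * (e * pm)).
    - replace (E * (t / eps * layer beta eps (x - t))) with
        (t / eps * (E * layer beta eps (x - t))) by ring.
      apply Rmult_le_compat_l; lra.
    - nra. }
  assert (Rp' : Rabs (residual eps b c w g v2 x (x + t)) <=
    (3 * (M * K) + M) * (eps * h) + M * K * (e + e + / beta * e)).
  { apply Rle_trans with (1 := Rp); apply Rplus_le_compat; apply Rmult_le_compat_l; nra. }
  assert (Rm' : Rabs (E * residual eps b c w g v2 x (x - t)) <=
    (3 * (M * K) + M) * (eps * h) + M * K * (e + e + / mu * e)).
  { rewrite Rabs_mult, (Rabs_pos_eq E) by lra.
    apply Rle_trans with (E * ((3 * (M * K) + M) * (eps * t)) + M * K * (E * layer beta eps (x - t)
      + E * layer beta eps (x - t) + E * (t / eps * layer beta eps (x - t)))).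
    - apply (Rmult_le_compat_l E) in Rm; [| lra]. lra.
    - apply Rplus_le_compat.
      + assert (0 <= (3 * (M * K) + M) * (eps * t)) by (apply Rmult_le_pos; nra).
        apply Rle_trans with ((3 * (M * K) + M) * (eps * t)); [nra |].
        apply Rmult_le_compat_l; nra.
      + apply Rmult_le_compat_l; lra. }
  eapply Rle_trans; [apply Rabs_add_le; eassumption |].
  assert (0 <= M * K * (4 + / beta + / mu) * (eps * h)).
  { repeat apply Rmult_le_pos; lra. }
  assert (0 <= (6 * (M * K) + 2 * M) * e) by (apply Rmult_le_pos; nra).
  lra.
Qed.

(** One fine step is at most [Y] layer widths, so the layer changes by a bounded factor across
    it. *)
Lemma layer_nearby (beta eps Y x h z : R) :
  0 < beta -> 0 < eps -> h <= Y * eps -> x - h <= z ->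
  layer beta eps z <= exp (beta * Y) * layer beta eps x.
Proof.
  intros Hb He Hh Hz; unfold layer; rewrite <- exp_plus; apply exp_le.
  assert (0 <= beta * (Y * eps - x + z) / eps).
  { apply Rmult_le_pos; [nra | left; now apply Rinv_0_lt_compat]. }
  replace (- (beta * z / eps)) with
    (beta * Y + - (beta * x / eps) - beta * (Y * eps - x + z) / eps) by (field; lra).
  lra.
Qed.

(* The factor [1 - exp (- b t / eps)] left over from pairing the linear parts at [x + t] and
   [x - t] supplies the second power of [h / eps]. *)
Lemma paired_residual_bound_fine (beta mu M K Y eps h t : R)
  (b b1 b2 c c1 c2 w g g2 v2 : R -> R) (x : R) :
  0 < beta -> 0 < mu -> 0 < M -> 0 < K -> 0 < Y ->
  layer_problem beta mu M eps b b1 b2 c c1 c2 w g g2 v2 ->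
  layer_bounds beta K eps w g g2 ->
  0 <= x - h -> x + h <= 1 -> 0 < t < h -> h <= Y * eps ->
  Rabs (residual eps b c w g v2 x (x + t)
        + exp (- (b x * t / eps)) * residual eps b c w g v2 x (x - t)) <=
  ((3 * M * M * K + 12 * (M * K)) * Y + 2 * M + 3 * M * M * K + 12 * (M * K) * exp (beta * Y))
  * (eps * h + (h / eps) ^ 2 * layer beta eps x).
Proof.
  intros Hbeta Hmu HM HK HY LP LB Hx0 Hx1 Ht HhY.
  destruct LP as [[He0 He1] Hb Hc Hblo Hclo Hcont Hw0 Hw1 Hd1 Hd2 Heq Hv Hvl].
  destruct LB as [Bw Bg Bg2 Bi].
  assert (HI : I01 x) by (unfold I01; lra).
  assert (Hbx := Hblo x HI).
  set (L := exp (beta * Y)).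
  assert (HL : 1 <= L) by (unfold L; pose proof (exp_ineq1_le (beta * Y)); nra).
  pose proof (layer_pos beta eps x) as Hl.
  assert (Hnear : forall z, x - h < z < x + h -> layer beta eps z <= L * layer beta eps x).
  { intros z Hz; apply layer_nearby with h; lra. }
  set (e := layer beta eps x) in *.
  (* Since eps < 1, e / eps^2 dominates e and e / eps: [K * D] bounds w, w' and w'' at once near the
     node. *)
  set (D := 1 + L * e / eps ^ 2).
  assert (Hde : forall z, x - h < z < x + h -> layer beta eps z / eps ^ 2 <= L * e / eps ^ 2).
  { intros z Hz; apply Rmult_le_compat_r; [| now apply Hnear].
    left; apply Rinv_0_lt_compat, pow_lt; lra. }
  assert (Hsc : forall z, 0 < layer beta eps z / eps ^ 2 /\
    layer beta eps z = eps * (eps * (layer beta eps z / eps ^ 2)) /\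
    layer beta eps z / eps = eps * (layer beta eps z / eps ^ 2)).
  { intros z; repeat split; try (field; lra).
    apply Rdiv_lt_0_compat; [apply layer_pos | apply pow_lt; lra]. }
  assert (Hw : forall z, x - h < z < x + h -> Rabs (w z) <= K * D).
  { intros z Hz; apply Rle_trans with (1 := Bw z ltac:(lra)); apply Rmult_le_compat_l; [lra |].
    specialize (Hde z Hz); destruct (Hsc z) as [P [-> _]]; unfold D.
    set (d := layer beta eps z / eps ^ 2) in *.
    assert (0 < eps * d) by nra. nra. }
  assert (Hg : forall z, x - h < z < x + h -> Rabs (g z) <= K * D).
  { intros z Hz; apply Rle_trans with (1 := Bg z ltac:(lra)); apply Rmult_le_compat_l; [lra |].
    specialize (Hde z Hz); destruct (Hsc z) as [P [_ ->]]; unfold D.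
    set (d := layer beta eps z / eps ^ 2) in *. nra. }
  assert (Hg2 : forall z, x - h < z < x + h -> Rabs (g2 z) <= K * D).
  { intros z Hz; apply Rle_trans with (1 := Bg2 z ltac:(lra)); apply Rmult_le_compat_l; [lra |].
    specialize (Hde z Hz); unfold D; lra. }
  assert (HD : 0 < D).
  { pose proof (Rabs_pos (w x)); specialize (Hw x ltac:(lra)).
    unfold D; assert (0 < L * e / eps ^ 2) by (apply Rdiv_lt_0_compat; [nra | apply pow_lt; lra]); lra. }
  (* The slope at z = x of the residual without its [v2] term; [v2] is only Lipschitz and
     contributes M (eps h) to [R0]. The 6 in [R0] is 4 from (c w)'' and 1 from each of the two
     remainders of (b z - b x) w' z. *)
  set (theta := c1 x * w x + c x * g x - b1 x * g x).
  set (R0 := 6 * (M * K * D) * h ^ 2 + M * (eps * h)).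
  assert (Hres : forall z, x - h < z < x + h ->
    Rabs (residual eps b c w g v2 x z - theta * (z - x)) <= R0).
  { intros z Hz.
    assert (Hzx : Rabs (z - x) < h) by (apply Rabs_def1; lra).
    assert (Tcw : Rabs (c z * w z - c x * w x - (c1 x * w x + c x * g x) * (z - x))
                  <= 4 * (M * (K * D)) * h ^ 2).
    { apply (second_order_taylor (fun y => c y * w y) (fun y => c1 y * w y + c y * g y)
        (fun y => c2 y * w y + 2 * (c1 y * g y) + c y * g2 y) _ h x z); [| | | exact Hzx].
      - intros y Hy.
        pose proof (C2_der1 _ _ _ _ Hc y ltac:(lra)) as Dc; specialize (Hd1 y ltac:(lra)).
        auto_derive; [repeat split; eexists; eassumption |].
        rewrite (is_derive_unique (fun y : R => c y) _ _ Dc),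
          (is_derive_unique (fun y : R => w y) _ _ Hd1); ring.
      - intros y Hy.
        pose proof (C2_der1 _ _ _ _ Hc y ltac:(lra)) as Dc; specialize (Hd1 y ltac:(lra)).
        pose proof (C2_der2 _ _ _ _ Hc y ltac:(lra)) as Dc1; specialize (Hd2 y ltac:(lra)).
        auto_derive; [repeat split; eexists; eassumption |].
        rewrite (is_derive_unique (fun y : R => c y) _ _ Dc), (is_derive_unique (fun y : R => c1 y) _ _ Dc1),
          (is_derive_unique (fun y : R => w y) _ _ Hd1), (is_derive_unique (fun y : R => g y) _ _ Hd2); ring.
      - intros y Hy; assert (HIy : I01 y) by (unfold I01; lra).
        replace (4 * (M * (K * D))) with (M * (K * D) + 2 * (M * (K * D)) + M * (K * D)) by ring.
        apply Rabs_add3_le; [| apply Rabs_mul_le; [rewrite Rabs_pos_eq; lra |] |];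
          (apply Rabs_mul_le; [| auto]).
        + now apply (C2_bound2 _ _ _ _ Hc).
        + now apply (C2_bound1 _ _ _ _ Hc).
        + now apply (C2_bound0 _ _ _ _ Hc). }
    assert (Tb : Rabs (b z - b x - b1 x * (z - x)) <= M * h ^ 2).
    { apply (second_order_taylor b b1 b2 _ h x z); [| | | exact Hzx].
      - intros y Hy; apply (C2_der1 _ _ _ _ Hb); lra.
      - intros y Hy; apply (C2_der2 _ _ _ _ Hb); lra.
      - intros y Hy; apply (C2_bound2 _ _ _ _ Hb); unfold I01; lra. }
    assert (Tg : Rabs (g z - g x) <= K * D * h).
    { destruct (Rtotal_order z x) as [Hlt | [-> | Hgt]].
      - destruct (mean_value g g2 z x Hlt) as [s [Hs E]].
        + intros; apply Hd2; lra.
        + intros s Hs; apply is_derive_continuity_pt with (g2 s); apply Hd2; lra.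
        + rewrite <- Rabs_Ropp, Ropp_minus_distr, E; apply Rabs_mul_le; [apply Hg2; lra |].
          rewrite Rabs_pos_eq; lra.
      - rewrite Rminus_diag, Rabs_R0; repeat apply Rmult_le_pos; lra.
      - destruct (mean_value g g2 x z Hgt) as [s [Hs E]].
        + intros; apply Hd2; lra.
        + intros s Hs; apply is_derive_continuity_pt with (g2 s); apply Hd2; lra.
        + rewrite E; apply Rabs_mul_le; [apply Hg2; lra |].
          rewrite Rabs_pos_eq; lra. }
    pose proof (Hvl z x ltac:(lra) ltac:(lra)) as Tv.
    replace (residual eps b c w g v2 x z - theta * (z - x)) with
      ((c z * w z - c x * w x - (c1 x * w x + c x * g x) * (z - x))
       - eps * (v2 z - v2 x) - (b z - b x - b1 x * (z - x)) * g z
       - b1 x * (z - x) * (g z - g x)) by (unfold residual, theta; ring).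
    eapply Rle_trans.
    { apply Rabs_sub_le; [apply Rabs_sub_le; [apply Rabs_sub_le |] |].
      - exact Tcw.
      - apply Rabs_mul_le; [rewrite Rabs_pos_eq; [apply Rle_refl | lra] | exact Tv].
      - apply Rabs_mul_le; [exact Tb | apply Hg; lra].
      - apply Rabs_mul_le; [apply Rabs_mul_le |].
        + now apply (C2_bound1 _ _ _ _ Hb).
        + left; exact Hzx.
        + exact Tg. }
    assert (0 <= eps * M * (h - Rabs (z - x))) by (repeat apply Rmult_le_pos; lra).
    unfold R0; nra. }
  (* Here [K * D] would be too weak: multiplied by h (h / eps), the sharper eps + e / eps gives the
     required orders eps h and (h / eps)^2 e. *)
  assert (Htheta : Rabs theta <= 3 * (M * (K * (eps + e / eps)))).
  { pose proof (Hsc x) as [P [E1 E2]]; fold e in P, E1, E2.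
    assert (Hee : e <= e / eps).
    { rewrite E1, E2 at 1; set (d := e / eps ^ 2) in *; assert (0 < eps * d) by nra; nra. }
    replace (3 * (M * (K * (eps + e / eps)))) with
      (M * (K * (eps + e / eps)) + M * (K * (eps + e / eps)) + M * (K * (eps + e / eps))) by ring.
    specialize (Bw x ltac:(lra)); specialize (Bg x ltac:(lra)); fold e in Bw, Bg.
    apply Rabs_sub_le; [apply Rabs_add_le |]; apply Rabs_mul_le; try exact Bg.
    - now apply (C2_bound1 _ _ _ _ Hc).
    - apply Rle_trans with (1 := Bw); apply Rmult_le_compat_l; lra.
    - now apply (C2_bound0 _ _ _ _ Hc).
    - now apply (C2_bound1 _ _ _ _ Hb). }
  set (E := exp (- (b x * t / eps))).
  assert (Hbt : 0 <= b x * t / eps)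
    by (apply Rmult_le_pos; [nra | left; now apply Rinv_0_lt_compat]).
  assert (HE : 0 < E <= 1) by (split; [apply exp_pos | now apply exp_neg_le_1]).
  assert (HE1 : 1 - E <= M * (h / eps)).
  { unfold E; pose proof (exp_ineq1_le (- (b x * t / eps))).
    assert (b x <= M) by (pose proof (C2_bound0 _ _ _ _ Hb x HI) as B; apply Rabs_le_between in B; lra).
    apply Rle_trans with (b x * t / eps); [lra |].
    unfold Rdiv; rewrite <- Rmult_assoc; apply Rmult_le_compat_r;
      [left; now apply Rinv_0_lt_compat | nra]. }
  pose proof (Hres (x + t) ltac:(lra)) as Rp; pose proof (Hres (x - t) ltac:(lra)) as Rm.
  replace (residual eps b c w g v2 x (x + t) + E * residual eps b c w g v2 x (x - t)) with
    (theta * (t * (1 - E)) + (residual eps b c w g v2 x (x + t) - theta * (x + t - x))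
     + E * (residual eps b c w g v2 x (x - t) - theta * (x - t - x))) by ring.
  eapply Rle_trans.
  { apply Rabs_add3_le; [apply Rabs_mul_le; [exact Htheta |] | exact Rp |].
    - instantiate (1 := h * (M * (h / eps))).
      rewrite Rabs_pos_eq by (apply Rmult_le_pos; lra).
      apply Rmult_le_compat; lra.
    - apply Rabs_mul_le; [rewrite Rabs_pos_eq; [apply HE | lra] | exact Rm]. }
  unfold R0, D.
  set (y := h / eps).
  assert (Eh : h = y * eps) by (unfold y; field; lra).
  assert (Hy0 : 0 < y) by (apply Rdiv_lt_0_compat; lra).
  assert (HyY : y <= Y) by (apply (Rmult_le_reg_r eps); lra).
  replace (3 * (M * (K * (eps + e / eps))) * (h * (M * y)))
    with (3 * M * M * K * (y * (eps * h) + y ^ 2 * e)) by (rewrite Eh; field; lra).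
  replace (6 * (M * K * (1 + L * e / eps ^ 2)) * h ^ 2)
    with (6 * (M * K) * (y * (eps * h) + L * (y ^ 2 * e))) by (rewrite Eh; field; lra).
  assert (P1 : 0 < eps * h) by (apply Rmult_lt_0_compat; lra).
  assert (P2 : 0 < y ^ 2 * e) by (apply Rmult_lt_0_compat; [apply pow_lt |]; lra).
  assert (P3 : y * (eps * h) <= Y * (eps * h)) by (apply Rmult_le_compat_r; lra).
  set (s := eps * h) in *; set (r := y ^ 2 * e) in *. clearbody s r.
  assert (PMK : 0 < M * K) by nra.
  assert (PMMK : 0 < M * M * K) by nra.
  assert (Q1 : M * M * K * (y * s) <= M * M * K * (Y * s)) by (apply Rmult_le_compat_l; lra).
  assert (Q2 : M * K * (y * s) <= M * K * (Y * s)) by (apply Rmult_le_compat_l; lra).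
  assert (Q3 : 0 <= (M * M * K) * s) by nra.
  assert (Q4 : 0 <= (M * K * L) * s) by (apply Rmult_le_pos; [apply Rmult_le_pos |]; lra).
  assert (Q5 : 0 <= ((3 * M * M * K + 12 * (M * K)) * Y + 2 * M) * r)
    by (apply Rmult_le_pos; [| lra]; assert (0 < (3 * M * M * K + 12 * (M * K)) * Y) by (apply Rmult_lt_0_compat; lra); lra).
  nra.
Qed.

(** * The discrete operator *)

Definition fitting (eps : R) (b : R -> R) (x : nat -> R) (i : nat) : R :=
  exp (- (b (x i) * hstep x (S i) / eps)).

Lemma fitting_bounds (eps : R) (b : R -> R) (x : nat -> R) (i : nat) :
  0 < eps -> 0 < b (x i) -> 0 < hstep x (S i) -> 0 < fitting eps b x i < 1.
Proof.
  intros He Hb Hh; unfold fitting; split; [apply exp_pos |].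
  rewrite <- exp_0; apply exp_increasing.
  assert (0 < b (x i) * hstep x (S i) / eps) by (apply Rdiv_lt_0_compat; nra); lra.
Qed.

(** With q = exp (- 2 rho), eps sigma / hbar equals b k q / (1 - q). The ratio [k] of the right step
    to the mean step is 1 on a uniform part. The opposite signs of the two difference coefficients
    give the comparison principle. *)
Lemma LN_fitting (eps : R) (b c : R -> R) (x U : nat -> R) (i : nat) :
  0 < eps -> 0 < b (x i) -> 0 < hstep x i -> 0 < hstep x (S i) ->
  let q := fitting eps b x i in
  let k := hstep x (S i) / hbar x i in
  LN eps b c x U i =
    b (x i) / (1 - q) * (k * q * Defs.Dminus x U i - (k * q + (1 - q)) * Defs.Dplus x U i) + c (x i) * U i.
Proof.
  intros He Hb Hm Hp q k.
  pose proof (fitting_bounds eps b x i He Hb Hp) as Hq; fold q in Hq.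
  assert (Hbar : 0 < hbar x i) by (unfold hbar; lra).
  assert (Hr : 0 < b (x i) * hstep x (S i) / (2 * eps)) by (apply Rdiv_lt_0_compat; nra).
  unfold LN, Defs.sigma, D2; cbv zeta.
  (* A positive [rho] excludes the special value of [sigma] at 0. *)
  match goal with |- context [Req_EM_T ?r 0] => destruct (Req_EM_T r 0) as [E | _]; [lra |] end.
  replace (exp (2 * (b (x i) * hstep x (S i) / (2 * eps)))) with (/ q).
  2: { unfold q, fitting; rewrite <- exp_Ropp; f_equal; field; lra. }
  unfold k; field; repeat split; lra.
Qed.

Lemma LN_uniform (eps : R) (b c : R -> R) (x U : nat -> R) (i : nat) (h : R) :
  0 < eps -> 0 < b (x i) -> 0 < h -> hstep x i = h -> hstep x (S i) = h ->
  let q := fitting eps b x i in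
  LN eps b c x U i =
    b (x i) / ((1 - q) * h) * (q * (U i - U (i - 1)%nat) - (U (S i) - U i)) + c (x i) * U i.
Proof.
  intros He Hb Hh E1 E2 q.
  pose proof (fitting_bounds eps b x i He Hb ltac:(lra)) as Hq; fold q in Hq.
  rewrite LN_fitting by lra; fold q; unfold Defs.Dminus, Defs.Dplus, hbar; rewrite E1, E2; field; lra.
Qed.

Lemma LN_linear (eps : R) (b c : R -> R) (x U V : nat -> R) (k l : R) (i : nat) :
  LN eps b c x (fun j => k * U j + l * V j) i = k * LN eps b c x U i + l * LN eps b c x V i.
Proof. unfold LN, D2, Defs.Dplus, Defs.Dminus, Rdiv; ring. Qed.

Lemma argmin_nat (U : nat -> R) (N : nat) :
  exists m, (m <= N)%nat /\ forall i, (i <= N)%nat -> U m <= U i.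
Proof.
  induction N as [| N [m [Hm IH]]].
  - exists 0%nat; split; [lia |]; intros i Hi; replace i with 0%nat by lia; lra.
  - destruct (Rle_lt_dec (U m) (U (S N))) as [H | H].
    + exists m; split; [lia |]; intros i Hi.
      destruct (Nat.eq_dec i (S N)) as [-> |]; [assumption | apply IH; lia].
    + exists (S N); split; [lia |]; intros i Hi.
      destruct (Nat.eq_dec i (S N)) as [-> |]; [lra | specialize (IH i ltac:(lia)); lra].
Qed.

(** At a negative interior minimum the backward difference is nonpositive and the forward one
    nonnegative, so every term of the fitted form is nonpositive. Strict positivity of the operator
    makes this an immediate contradiction, with no propagation of the minimum to its neighbours. *)
Lemma discrete_comparison (eps : R) (b c : R -> R) (x U : nat -> R) (N : nat) :
  0 < eps ->
  (forall i, (1 <= i <= N)%nat -> 0 < hstep x i) ->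
  (forall i, (1 <= i <= N - 1)%nat -> 0 < b (x i) /\ 0 <= c (x i)) ->
  (forall i, (1 <= i <= N - 1)%nat -> 0 < LN eps b c x U i) ->
  0 <= U 0%nat -> 0 <= U N ->
  forall i, (i <= N)%nat -> 0 <= U i.
Proof.
  intros He Hh Hbc HL H0 HN i Hi.
  destruct (argmin_nat U N) as [m [Hm Hmin]].
  destruct (Rle_lt_dec 0 (U m)) as [| Hneg]; [specialize (Hmin i Hi); lra | exfalso].
  assert (m <> 0%nat) by (intros ->; lra).
  assert (m <> N) by (intros ->; lra).
  assert (Hm1 : (1 <= m <= N - 1)%nat) by lia.
  destruct (Hbc m Hm1) as [Hb Hc]; specialize (HL m Hm1).
  pose proof (Hh m ltac:(lia)) as Hhm; pose proof (Hh (S m) ltac:(lia)) as Hhp.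
  pose proof (Hmin (S m) ltac:(lia)); pose proof (Hmin (m - 1)%nat ltac:(lia)).
  rewrite LN_fitting in HL by assumption.
  pose proof (fitting_bounds eps b x m He Hb Hhp) as Hq.
  set (q := fitting eps b x m) in *.
  assert (Hk : 0 < hstep x (S m) / hbar x m) by (apply Rdiv_lt_0_compat; unfold hbar; lra).
  set (k := hstep x (S m) / hbar x m) in *.
  assert (HDm : Defs.Dminus x U m <= 0).
  { unfold Defs.Dminus, Rdiv; assert (0 < / hstep x m) by (now apply Rinv_0_lt_compat); nra. }
  assert (HDp : 0 <= Defs.Dplus x U m).
  { unfold Defs.Dplus, Rdiv; assert (0 < / hstep x (S m)) by (now apply Rinv_0_lt_compat); nra. }
  assert (Hbq : 0 < b (x m) / (1 - q)) by (apply Rdiv_lt_0_compat; lra).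
  assert (0 < k * q) by nra.
  assert (k * q * Defs.Dminus x U m - (k * q + (1 - q)) * Defs.Dplus x U m <= 0) by nra.
  nra.
Qed.

(** The truncation error is - b / ((1 - q) h) times the quantity in [fitted_difference_bound], and
    the prefactor cancels the factor h (1 - q) / b of that bound. *)
Lemma truncation_uniform (beta mu M eps m h : R) (b b1 b2 c c1 c2 w g g2 v2 : R -> R)
  (x : nat -> R) (i : nat) :
  0 < beta -> 0 < mu -> 0 <= m -> 0 < h ->
  layer_problem beta mu M eps b b1 b2 c c1 c2 w g g2 v2 ->
  hstep x i = h -> hstep x (S i) = h -> 0 <= x i - h -> x i + h <= 1 -> (1 <= i)%nat ->
  (forall t, 0 < t < h ->
     Rabs (residual eps b c w g v2 (x i) (x i + t)
        + exp (- (b (x i) * t / eps)) * residual eps b c w g v2 (x i) (x i - t)) <= m) ->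
  Rabs (LN eps b c x (fun j => w (x j)) i - eps * v2 (x i)) <= m.
Proof.
  intros Hbeta Hmu Hm Hh LP E1 E2 Hx0 Hx1 Hi Hres.
  assert (Hx : 0 < x i < 1) by lra.
  assert (He : 0 < eps) by apply (lp_eps _ _ _ _ _ _ _ _ _ _ _ _ _ _ LP).
  assert (Hb : 0 < b (x i)).
  { pose proof (lp_b_lower _ _ _ _ _ _ _ _ _ _ _ _ _ _ LP (x i) ltac:(unfold I01; lra)); lra. }
  pose proof (fitting_bounds eps b x i He Hb ltac:(lra)) as Hq.
  rewrite (LN_uniform eps b c x _ i h) by assumption; cbv zeta.
  assert (Eq : fitting eps b x i = exp (- (b (x i) * h / eps))) by (unfold fitting; now rewrite E2).
  assert (Ep : x (S i) = x i + h) by (unfold hstep in E2; simpl in E2; rewrite Nat.sub_0_r in E2; lra).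
  assert (Em : x (i - 1)%nat = x i - h) by (unfold hstep in E1; lra).
  rewrite Ep, Em; set (q := fitting eps b x i) in *.
  assert (HF := fitted_difference_bound w g g2 eps (b (x i))
    (c (x i) * w (x i) - eps * v2 (x i)) m (x i) h He Hb Hm Hh
    (lp_cont _ _ _ _ _ _ _ _ _ _ _ _ _ _ LP)
    (fun z Hz => lp_der1 _ _ _ _ _ _ _ _ _ _ _ _ _ _ LP z ltac:(lra))
    (fun z Hz => lp_der2 _ _ _ _ _ _ _ _ _ _ _ _ _ _ LP z ltac:(lra))).
  cbv zeta in HF; rewrite <- Eq in HF.
  assert (HF' := HF ltac:(intros t Ht;
    rewrite !(residual_eq _ _ _ _ _ _ _ _ _ _ _ _ _ _ (x i) _ LP) by lra; apply Hres; lra)).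
  clear HF.
  replace (b (x i) / ((1 - q) * h) * (q * (w (x i) - w (x i - h)) - (w (x i + h) - w (x i)))
           + c (x i) * w (x i) - eps * v2 (x i)) with
    (- (b (x i) / ((1 - q) * h)) * (w (x i + h) - w (x i) - q * (w (x i) - w (x i - h))
      - (c (x i) * w (x i) - eps * v2 (x i)) / b (x i) * h * (1 - q))) by (field; lra).
  assert (Hp : 0 < b (x i) / ((1 - q) * h)) by (apply Rdiv_lt_0_compat; nra).
  rewrite Rabs_mult, Rabs_Ropp, (Rabs_pos_eq (b (x i) / ((1 - q) * h))) by lra.
  apply Rle_trans with (b (x i) / ((1 - q) * h) * (m / b (x i) * h * (1 - q))).
  - apply Rmult_le_compat_l; lra.
  - right; field; lra.
Qed.

Lemma LN_linear_barrier (eps : R) (b c : R -> R) (x : nat -> R) (i : nat) :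
  0 < eps -> 0 < b (x i) -> 0 < hstep x i -> 0 < hstep x (S i) ->
  LN eps b c x (fun j => 1 - x j) i = b (x i) + c (x i) * (1 - x i).
Proof.
  intros He Hb Hm Hp; rewrite LN_fitting by assumption; cbv zeta.
  pose proof (fitting_bounds eps b x i He Hb Hp) as Hq.
  replace (Defs.Dminus x (fun j => 1 - x j) i) with (-1) by (unfold Defs.Dminus, hstep in *; field; lra).
  replace (Defs.Dplus x (fun j => 1 - x j) i) with (-1).
  2: { unfold Defs.Dplus, hstep in *; simpl in *; rewrite Nat.sub_0_r in *; field; lra. }
  field; split; [unfold hbar |]; lra.
Qed.

Lemma LN_constant (eps : R) (b c : R -> R) (x U : nat -> R) (i : nat) :
  U (S i) = U i -> U (i - 1)%nat = U i -> LN eps b c x U i = c (x i) * U i.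
Proof. intros E1 E2; unfold LN, D2, Defs.Dplus, Defs.Dminus; rewrite E1, E2; unfold Rdiv; ring. Qed.

(** On a geometric grid function of ratio p, writing q = p r turns the difference part q (1 - 1/p) +
    1 - p into (1 - p) (1 - r). Both factors are positive when 0 < beta < b. *)
Lemma LN_layer_barrier (eps beta : R) (b c : R -> R) (x U : nat -> R) (i : nat) (h : R) :
  0 < eps -> 0 < b (x i) -> 0 < h -> hstep x i = h -> hstep x (S i) = h ->
  U (S i) = U i * exp (- (beta * h / eps)) -> U i = U (i - 1)%nat * exp (- (beta * h / eps)) ->
  LN eps b c x U i =
    b (x i) / ((1 - fitting eps b x i) * h) * (1 - exp (- (beta * h / eps)))
    * (1 - exp (- ((b (x i) - beta) * h / eps))) * U i + c (x i) * U i.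
Proof.
  intros He Hb Hh E1 E2 Hp Hm.
  pose proof (fitting_bounds eps b x i He Hb ltac:(lra)) as Hq.
  rewrite (LN_uniform eps b c x U i h) by assumption; cbv zeta.
  assert (Eq : fitting eps b x i = exp (- ((b (x i) - beta) * h / eps)) * exp (- (beta * h / eps))).
  { unfold fitting; rewrite E2, <- exp_plus; f_equal; field; lra. }
  rewrite Hp, Hm, Eq in *.
  set (p := exp (- (beta * h / eps))) in *; set (r := exp (- ((b (x i) - beta) * h / eps))) in *.
  field; split; lra.
Qed.

(** * The two-step grid: transition point and barriers *)

(** Isolates the facts about the mesh that the error analysis uses, so that the explicit formula
    enters only once, in [shishkin_two_step_grid]. *)
Record two_step_grid (x : nat -> R) (N J : nat) (h H : R) : Prop := {
  tg_J : (1 <= J < N)%nat;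
  tg_h : 0 < h;
  tg_hH : h <= H;
  tg_fine : forall i, (1 <= i <= J)%nat -> hstep x i = h;
  tg_coarse : forall i, (J < i <= N)%nat -> hstep x i = H;
  tg_0 : x 0%nat = 0;
  tg_1 : x N = 1 }.

Lemma grid_step (x : nat -> R) (N J : nat) (h H : R) (i : nat) :
  two_step_grid x N J h H -> (1 <= i <= N)%nat -> 0 < hstep x i <= H.
Proof.
  intros [HJ Hh HhH Hf Hc H0 H1] Hi; destruct (Compare_dec.le_lt_dec i J).
  - rewrite Hf by lia; lra.
  - rewrite Hc by lia; lra.
Qed.

Lemma hstep_succ (x : nat -> R) (i : nat) : x (S i) = x i + hstep x (S i).
Proof. unfold hstep; simpl; rewrite Nat.sub_0_r; ring. Qed.

Lemma grid_mono (x : nat -> R) (N J : nat) (h H : R) (i j : nat) :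
  two_step_grid x N J h H -> (i <= j <= N)%nat -> x i <= x j.
Proof.
  intros G [Hij HjN]; induction j as [| j IH].
  - replace i with 0%nat by lia; lra.
  - destruct (Nat.eq_dec i (S j)) as [-> |]; [lra |].
    specialize (IH ltac:(lia) ltac:(lia)).
    pose proof (grid_step x N J h H (S j) G ltac:(lia)); rewrite (hstep_succ x); lra.
Qed.

Lemma grid_mono_strict (x : nat -> R) (N J : nat) (h H : R) (i j : nat) :
  two_step_grid x N J h H -> (i < j <= N)%nat -> x i < x j.
Proof.
  intros G Hij; pose proof (grid_mono x N J h H (S i) j G ltac:(lia)).
  pose proof (grid_step x N J h H (S i) G ltac:(lia)); rewrite (hstep_succ x) in *; lra.
Qed.

Lemma grid_interior (x : nat -> R) (N J : nat) (h H : R) (i : nat) :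
  two_step_grid x N J h H -> (1 <= i <= N - 1)%nat -> 0 < x i < 1.
Proof.
  intros G Hi; pose proof (tg_J _ _ _ _ _ G).
  rewrite <- (tg_0 _ _ _ _ _ G) at 1; rewrite <- (tg_1 _ _ _ _ _ G).
  split; eapply grid_mono_strict; eauto; lia.
Qed.

Lemma layer_antitone (beta eps x y : R) :
  0 < beta -> 0 < eps -> x <= y -> layer beta eps y <= layer beta eps x.
Proof.
  intros Hb He Hxy; unfold layer; apply exp_le, Ropp_le_contravar.
  apply Rmult_le_compat_r; [left; now apply Rinv_0_lt_compat | nra].
Qed.

Lemma exp_quadratic_lower (z : R) : 0 <= z -> 1 + z * z / 4 <= exp z.
Proof.
  intros Hz; replace z with (z / 2 + z / 2) at 3 by field.
  rewrite exp_plus; pose proof (exp_ineq1_le (z / 2)); nra.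
Qed.

(** b q / (1 - q) is b / (exp z - 1) with z = b H / eps. The bounds come from exp z - 1 >= z and exp
    z - 1 >= z^2 / 4; the second compensates the factor 1 / eps^2 in w''. *)
Lemma fitting_ratio_bounds (bi H eps : R) :
  0 < bi -> 0 < H -> 0 < eps ->
  let q := exp (- (bi * H / eps)) in
  bi * q / (1 - q) <= eps / H /\ bi * q / (1 - q) * (H / eps) ^ 2 <= 4 / bi.
Proof.
  intros Hb HH He q.
  assert (Hz : 0 < bi * H / eps) by (apply Rdiv_lt_0_compat; nra).
  assert (Hq : 0 < q < 1).
  { unfold q; split; [apply exp_pos |]; rewrite <- exp_0; apply exp_increasing; lra. }
  pose proof (exp_neg_mul_le (bi * H / eps)) as B1; fold q in B1.
  assert (B2 : q * (bi * H / eps * (bi * H / eps) / 4) <= 1 - q).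
  { pose proof (exp_quadratic_lower (bi * H / eps) ltac:(lra)) as B.
    apply (Rmult_le_compat_l q) in B; [| lra].
    unfold q in B at 2; rewrite <- exp_plus, Rplus_opp_l, exp_0 in B; lra. }
  assert (Hi : 0 < / (1 - q)) by (apply Rinv_0_lt_compat; lra).
  assert (HeH : 0 < eps / H) by (apply Rdiv_lt_0_compat; lra).
  split.
  - replace (bi * q / (1 - q)) with (q * (bi * H / eps) * (eps / H) * / (1 - q)) by (field; lra).
    replace (eps / H) with ((1 - q) * (eps / H) * / (1 - q)) at 2 by (field; lra).
    apply Rmult_le_compat_r; [lra |]; apply Rmult_le_compat_r; lra.
  - assert (H4 : 0 < 4 / bi) by (apply Rdiv_lt_0_compat; lra).
    replace (bi * q / (1 - q) * (H / eps) ^ 2) with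
      (q * (bi * H / eps * (bi * H / eps) / 4) * (4 / bi) * / (1 - q)) by (field; lra).
    replace (4 / bi) with ((1 - q) * (4 / bi) * / (1 - q)) at 2 by (field; lra).
    apply Rmult_le_compat_r; [lra |]; apply Rmult_le_compat_r; lra.
Qed.

Lemma truncation_transition (beta mu M K Y eps h H : R) (b b1 b2 c c1 c2 w g g2 v2 : R -> R)
  (x : nat -> R) (N J : nat) :
  0 < beta -> 0 < mu -> 0 < M -> 0 < K -> 0 < Y ->
  layer_problem beta mu M eps b b1 b2 c c1 c2 w g g2 v2 ->
  layer_bounds beta K eps w g g2 ->
  two_step_grid x N J h H -> h <= Y * eps ->
  Rabs (LN eps b c x (fun j => w (x j)) J - eps * v2 (x J)) <=
  (4 * K + 16 * K * exp (beta * Y) / beta + 2 * M * K + M) * (eps + layer beta eps (x J) / H).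
Proof.
  intros Hbeta Hmu HM HK HY LP LB G HhY.
  assert (HxJ : 0 < x J < 1) by (apply (grid_interior _ _ _ _ _ _ G); destruct (tg_J _ _ _ _ _ G); lia).
  pose proof (grid_mono x N J h H 0 (J - 1) G ltac:(destruct (tg_J _ _ _ _ _ G); lia)) as Hm0.
  pose proof (grid_mono x N J h H (S J) N G ltac:(destruct (tg_J _ _ _ _ _ G); lia)) as Hp1.
  destruct G as [HJ Hh HhH Hf Hc H0 H1].
  destruct LP as [[He0 He1] Cb Cc Hblo Hclo Hcont Hw0 Hw1 Hd1 Hd2 Heq Hv Hvl].
  destruct LB as [Bw Bg Bg2 Bi].
  assert (HI : I01 (x J)) by (unfold I01; lra).
  assert (Hb : 0 < b (x J)) by (specialize (Hblo _ HI); lra).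
  assert (E1 : hstep x J = h) by (apply Hf; lia).
  assert (E2 : hstep x (S J) = H) by (apply Hc; lia).
  rewrite (hstep_succ x), E2, H1 in Hp1; rewrite H0 in Hm0.
  assert (Em : x (J - 1)%nat = x J - h) by (unfold hstep in E1; lra).
  rewrite Em in Hm0.
  rewrite LN_fitting by lra; cbv zeta.
  pose proof (fitting_bounds eps b x J He0 Hb ltac:(lra)) as Hq.
  destruct (fitting_ratio_bounds (b (x J)) H eps Hb ltac:(lra) He0) as [F1 F2].
  cbv zeta in F1, F2; rewrite <- E2 in F1 at 1 2; rewrite <- E2 in F2 at 1 2.
  change (exp (- (b (x J) * hstep x (S J) / eps))) with (fitting eps b x J) in F1, F2.
  set (q := fitting eps b x J) in *.
  assert (Hk : 0 < hstep x (S J) / hbar x J <= 2).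
  { unfold hbar; rewrite E1, E2; split; [apply Rdiv_lt_0_compat; lra |].
    apply (Rmult_le_reg_r ((h + H) / 2)); [lra |].
    replace (H / ((h + H) / 2) * ((h + H) / 2)) with H by (field; lra); lra. }
  set (k := hstep x (S J) / hbar x J) in *.
  set (L := exp (beta * Y)) in *.
  assert (HL : 0 < L) by apply exp_pos.
  pose proof (layer_pos beta eps (x J)) as Hl.
  set (e := layer beta eps (x J)) in *.
  assert (HeH : e <= e / H).
  { apply (Rmult_le_reg_r H); [lra |]; replace (e / H * H) with e by (field; lra); nra. }
  assert (HDp : Rabs (Defs.Dplus x (fun j => w (x j)) J) <= K * (eps + e / H)).
  { unfold Defs.Dplus; rewrite E2, (hstep_succ x), E2; unfold Rdiv at 1.
    rewrite Rabs_mult, (Rabs_pos_eq (/ H)) by (left; apply Rinv_0_lt_compat; lra).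
    specialize (Bi (x J) (x J + H) ltac:(lra) ltac:(lra) ltac:(lra)).
    replace (K * (eps + e / H)) with (K * (eps * (x J + H - x J) + e) * / H) by (field; lra).
    apply Rmult_le_compat_r; [left; apply Rinv_0_lt_compat; lra | exact Bi]. }
  assert (HDm : Rabs (Defs.Dminus x (fun j => w (x j)) J - Defs.Dplus x (fun j => w (x j)) J)
                <= K * (1 + L * e / eps ^ 2) * (2 * H)).
  { unfold Defs.Dplus, Defs.Dminus; rewrite E1, E2, Em, (hstep_succ x), E2.
    destruct (mean_value w g (x J - h) (x J)) as [z1 [Hz1 Q1]]; [lra | | |].
    { intros; apply Hd1; lra. } { intros; apply Hcont. }
    destruct (mean_value w g (x J) (x J + H)) as [z2 [Hz2 Q2]]; [lra | | |].
    { intros; apply Hd1; lra. } { intros; apply Hcont. }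
    rewrite Q1, Q2.
    replace (g z1 * (x J - (x J - h)) / h) with (g z1) by (field; lra).
    replace (g z2 * (x J + H - x J) / H) with (g z2) by (field; lra).
    destruct (mean_value g g2 z1 z2) as [z [Hz Q]]; [lra | | |].
    { intros; apply Hd2; lra. }
    { intros y Hy; apply is_derive_continuity_pt with (g2 y); apply Hd2; lra. }
    rewrite <- Rabs_Ropp, Ropp_minus_distr, Q; apply Rabs_mul_le; [| rewrite Rabs_pos_eq; lra].
    apply Rle_trans with (1 := Bg2 z ltac:(lra)); apply Rmult_le_compat_l; [lra |].
    apply Rplus_le_compat_l, Rmult_le_compat_r; [left; apply Rinv_0_lt_compat, pow_lt; lra |].
    apply layer_nearby with h; lra. }
  set (Dm := Defs.Dminus x (fun j => w (x j)) J) in *.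
  set (Dp := Defs.Dplus x (fun j => w (x j)) J) in *.
  replace (b (x J) / (1 - q) * (k * q * Dm - (k * q + (1 - q)) * Dp) + c (x J) * w (x J) - eps * v2 (x J))
    with (k * (b (x J) * q / (1 - q) * (Dm - Dp)) - b (x J) * Dp + c (x J) * w (x J) - eps * v2 (x J))
    by (field; lra).
  set (r := b (x J) * q / (1 - q)) in *.
  assert (Hr : 0 < r) by (apply Rdiv_lt_0_compat; nra).
  assert (T1 : Rabs (k * (r * (Dm - Dp))) <= 2 * (2 * K * (eps + 4 * L / beta * (e / H)))).
  { apply Rabs_mul_le; [rewrite Rabs_pos_eq; lra |].
    rewrite Rabs_mult, (Rabs_pos_eq r) by lra.
    apply Rle_trans with (r * (K * (1 + L * e / eps ^ 2) * (2 * H))); [apply Rmult_le_compat_l; lra |].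
    replace (r * (K * (1 + L * e / eps ^ 2) * (2 * H))) with
      (2 * K * (r * H + L * (e / H) * (r * (H / eps) ^ 2))) by (field; lra).
    apply Rmult_le_compat_l; [lra |].
    assert (A1 : r * H <= eps).
    { apply (Rmult_le_compat_r H) in F1; [| lra].
      replace (eps / H * H) with eps in F1 by (field; lra); lra. }
    assert (A2 : 4 / b (x J) <= 4 / beta).
    { apply Rmult_le_compat_l; [lra |]; apply Rinv_le_contravar; [lra |].
      specialize (Hblo _ HI); lra. }
    assert (A3 : L * (e / H) * (r * (H / eps) ^ 2) <= L * (e / H) * (4 / beta)).
    { apply Rmult_le_compat_l; [apply Rmult_le_pos; lra | lra]. }
    replace (4 * L / beta * (e / H)) with (L * (e / H) * (4 / beta)) by (field; lra); lra. }
  assert (Hbw := Bw (x J) ltac:(lra)); fold e in Hbw.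
  eapply Rle_trans.
  { apply Rabs_sub_le; [apply Rabs_add_le; [apply Rabs_sub_le; [exact T1 |] |] |].
    - apply Rabs_mul_le; [now apply (C2_bound0 _ _ _ _ Cb) | exact HDp].
    - apply Rabs_mul_le; [now apply (C2_bound0 _ _ _ _ Cc) | exact Hbw].
    - apply Rabs_mul_le; [rewrite Rabs_pos_eq; [apply Rle_refl | lra] | apply Hv; lra]. }
  assert (0 < M * K) by nra.
  assert (M * K * (eps + e) <= M * K * (eps + e / H)) by (apply Rmult_le_compat_l; lra).
  assert (P : 0 < K * L / beta) by (apply Rdiv_lt_0_compat; nra).
  assert (0 <= (4 * K + M) * (e / H)) by (apply Rmult_le_pos; lra).
  assert (0 <= K * L / beta * eps) by (apply Rmult_le_pos; lra).
  replace (16 * K * L / beta) with (16 * (K * L / beta)) by (field; lra).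
  replace (2 * (2 * K * (eps + 4 * L / beta * (e / H)))) with
    (4 * K * eps + 16 * (K * L / beta) * (e / H)) by (field; lra).
  assert (K * (e / H) >= 0) by (apply Rle_ge, Rmult_le_pos; lra).
  lra.
Qed.

(** H / eps may be small or large. If beta H / eps <= 1, both exponential gaps are compared with
    linear functions of it; otherwise the right gap is at least 1/2 and the left one at most 1. *)
Lemma barrier_transition_ratio (beta bi H eps : R) :
  0 < beta -> beta <= bi -> 0 < H -> 0 < eps ->
  beta / 2 * (1 - exp (- (bi * H / eps))) <= bi * (1 - exp (- (beta * H / eps))).
Proof.
  intros Hb Hbi HH He.
  assert (Hd : 0 < H / eps) by (apply Rdiv_lt_0_compat; lra).
  replace (bi * H / eps) with (bi * (H / eps)) by (field; lra).
  replace (beta * H / eps) with (beta * (H / eps)) by (field; lra).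
  set (d := H / eps) in *; clearbody d.
  pose proof (exp_ineq1_le (- (bi * d))) as U; pose proof (exp_pos (- (bi * d))) as P.
  pose proof (exp_neg_mul_le (beta * d)) as B; pose proof (exp_pos (- (beta * d))) as P'.
  set (p := exp (- (beta * d))) in *; set (q := exp (- (bi * d))) in *.
  assert (Hbd : 0 < beta * d) by nra.
  destruct (Rle_lt_dec (beta * d) 1).
  - assert (beta * d / 2 <= 1 - p) by nra.
    apply Rle_trans with (bi * (beta * d / 2)); [nra | apply Rmult_le_compat_l; lra].
  - assert (1 / 2 <= 1 - p) by nra.
    apply Rle_trans with (bi * (1 / 2)); [nra | apply Rmult_le_compat_l; lra].
Qed.

(** Flat, then decaying: the concave kink at [J] makes the operator of order 1 / H there. The two
    branches agree at [J]. *)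
Definition tail_barrier (beta eps : R) (x : nat -> R) (J k : nat) : R :=
  if (k <=? J)%nat then 1 else layer beta eps (x k - x J).

(** The layer is followed on the fine part and frozen at its value at [J] afterwards. The convex
    kink costs a negative contribution of order e (x_J) / H, which [tail_barrier] will pay for. *)
Definition layer_barrier (beta eps : R) (x : nat -> R) (J k : nat) : R :=
  if (k <=? J)%nat then layer beta eps (x k) else layer beta eps (x J).

Lemma tail_barrier_le (beta eps : R) (x : nat -> R) (J k : nat) :
  (k <= J)%nat -> tail_barrier beta eps x J k = 1.
Proof. intros Hk; unfold tail_barrier; apply Nat.leb_le in Hk; now rewrite Hk. Qed.

Lemma layer_0 (beta eps : R) : layer beta eps 0 = 1.
Proof. unfold layer; replace (- (beta * 0 / eps)) with 0 by (unfold Rdiv; ring); apply exp_0. Qed.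

Lemma tail_barrier_ge (beta eps : R) (x : nat -> R) (J k : nat) :
  (J <= k)%nat -> tail_barrier beta eps x J k = layer beta eps (x k - x J).
Proof.
  intros Hk; unfold tail_barrier; destruct (Nat.leb_spec k J); [| reflexivity].
  replace k with J by lia; rewrite Rminus_diag; symmetry; apply layer_0.
Qed.

Lemma layer_barrier_le (beta eps : R) (x : nat -> R) (J k : nat) :
  (k <= J)%nat -> layer_barrier beta eps x J k = layer beta eps (x k).
Proof. intros Hk; unfold layer_barrier; apply Nat.leb_le in Hk; now rewrite Hk. Qed.

Lemma layer_barrier_ge (beta eps : R) (x : nat -> R) (J k : nat) :
  (J <= k)%nat -> layer_barrier beta eps x J k = layer beta eps (x J).
Proof.
  intros Hk; unfold layer_barrier; destruct (Nat.leb_spec k J); [| reflexivity].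
  now replace k with J by lia.
Qed.

Lemma tail_barrier_bounds (beta eps h H : R) (x : nat -> R) (N J k : nat) :
  0 < beta -> 0 < eps -> two_step_grid x N J h H -> (k <= N)%nat ->
  0 < tail_barrier beta eps x J k <= 1.
Proof.
  intros Hb He G Hk; destruct (Compare_dec.le_lt_dec k J).
  - rewrite tail_barrier_le by assumption; lra.
  - rewrite tail_barrier_ge by lia; split; [apply layer_pos |].
    apply layer_le_1; auto. pose proof (grid_mono x N J h H J k G ltac:(lia)); lra.
Qed.

Lemma layer_barrier_bounds (beta eps h H : R) (x : nat -> R) (N J k : nat) :
  0 < beta -> 0 < eps -> two_step_grid x N J h H -> (k <= N)%nat ->
  0 < layer_barrier beta eps x J k <= 1.
Proof.
  intros Hb He G Hk; pose proof (tg_J _ _ _ _ _ G); pose proof (tg_0 _ _ _ _ _ G) as G0.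
  unfold layer_barrier; destruct (k <=? J)%nat; (split; [apply layer_pos |]);
    apply layer_le_1; auto; rewrite <- G0; eapply grid_mono; eauto; lia.
Qed.

Lemma exp_neg_lower (s Y : R) : 0 <= s <= Y -> exp (- Y) * s <= 1 - exp (- s).
Proof.
  intros Hs; pose proof (exp_neg_mul_le s).
  assert (exp (- Y) <= exp (- s)) by (apply exp_le; lra).
  assert (exp (- Y) * s <= exp (- s) * s) by (apply Rmult_le_compat_r; lra); lra.
Qed.

(** Before [J] only c times a constant remains; after [J] the factorization in [LN_layer_barrier] is
    nonnegative; at [J] the backward difference vanishes and [barrier_transition_ratio] bounds the
    forward one. *)
Lemma LN_tail_barrier (beta mu M eps h H : R) (b c : R -> R) (x : nat -> R) (N J i : nat) :
  0 < beta -> 0 < mu -> 0 < eps ->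
  (forall y, I01 y -> beta + mu <= b y) -> (forall y, I01 y -> 0 <= c y) ->
  two_step_grid x N J h H -> (1 <= i <= N - 1)%nat ->
  0 <= LN eps b c x (tail_barrier beta eps x J) i /\
  (i = J -> beta / 2 / H <= LN eps b c x (tail_barrier beta eps x J) i).
Proof.
  intros Hbeta Hmu He Hblo Hclo G Hi.
  pose proof (grid_interior _ _ _ _ _ _ G Hi) as Hx.
  assert (HI : I01 (x i)) by (unfold I01; lra).
  specialize (Hblo _ HI); specialize (Hclo _ HI).
  pose proof (tail_barrier_bounds beta eps h H x N J i Hbeta He G ltac:(lia)) as HB.
  destruct G as [HJ Hh HhH Hf Hc H0 H1].
  destruct (Nat.lt_trichotomy i J) as [Hlt | [-> | Hgt]].
  - rewrite LN_constant by (rewrite !tail_barrier_le by lia; reflexivity).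
    split; [apply Rmult_le_pos; lra | lia].
  - enough (beta / 2 / H <= LN eps b c x (tail_barrier beta eps x J) J).
    { split; [| auto]. assert (0 < beta / 2 / H) by (repeat apply Rdiv_lt_0_compat; lra); lra. }
    assert (E1 : hstep x J = h) by (apply Hf; lia).
    assert (E2 : hstep x (S J) = H) by (apply Hc; lia).
    rewrite LN_fitting by lra; cbv zeta.
    pose proof (fitting_bounds eps b x J He ltac:(lra) ltac:(lra)) as Hq.
    pose proof (barrier_transition_ratio beta (b (x J)) H eps Hbeta ltac:(lra) ltac:(lra) He) as HR.
    unfold Defs.Dminus, Defs.Dplus, hbar; rewrite E1, E2.
    rewrite (tail_barrier_le _ _ _ _ (J - 1)), (tail_barrier_le _ _ _ _ J) by lia.
    rewrite tail_barrier_ge, (hstep_succ x), E2 by lia.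
    replace (x J + H - x J) with H by ring; unfold layer.
    assert (Eq : fitting eps b x J = exp (- (b (x J) * H / eps))) by (unfold fitting; now rewrite E2).
    rewrite Eq in *; set (q := exp (- (b (x J) * H / eps))) in *.
    set (p := exp (- (beta * H / eps))) in *.
    (* Since h <= H, the weight k q + (1 - q) of the forward difference is at least 1. *)
    assert (Hk : 1 <= H / ((h + H) / 2)).
    { apply (Rmult_le_reg_r ((h + H) / 2)); [lra |].
      replace (H / ((h + H) / 2) * ((h + H) / 2)) with H by (field; lra); lra. }
    set (k := H / ((h + H) / 2)) in *.
    replace (b (x J) / (1 - q) * (k * q * ((1 - 1) / h) - (k * q + (1 - q)) * ((p - 1) / H)) + c (x J) * 1)
      with ((k * q + (1 - q)) * (b (x J) * (1 - p)) / ((1 - q) * H) + c (x J)) by (field; lra).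
    assert (beta / 2 / H <= (k * q + (1 - q)) * (b (x J) * (1 - p)) / ((1 - q) * H)); [| lra].
    replace (beta / 2 / H) with (1 * (beta / 2 * (1 - q)) / ((1 - q) * H)) by (field; lra).
    apply Rmult_le_compat_r; [left; apply Rinv_0_lt_compat; nra |].
    apply Rmult_le_compat; nra.
  - split; [| lia].
    rewrite (LN_layer_barrier eps beta b c x _ i H);
      [ | assumption | lra | lra | apply Hc; lia | apply Hc; lia | | ].
    + pose proof (fitting_bounds eps b x i He ltac:(lra)
        ltac:(rewrite Hc by lia; lra)) as Hq.
      assert (Hs : forall k, 0 < k -> 0 <= 1 - exp (- (k * H / eps))).
      { intros k Hk; pose proof (exp_neg_le_1 (k * H / eps)
          ltac:(apply Rmult_le_pos; [nra | left; now apply Rinv_0_lt_compat])); lra. }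
      pose proof (Hs beta Hbeta); pose proof (Hs (b (x i) - beta) ltac:(lra)).
      apply Rplus_le_le_0_compat; [| apply Rmult_le_pos; lra].
      repeat apply Rmult_le_pos; try lra.
      left; apply Rinv_0_lt_compat; nra.
    + rewrite !tail_barrier_ge, (hstep_succ x), Hc by lia.
      replace (x i + H - x J) with (x i - x J + H) by ring; now rewrite layer_add.
    + rewrite !tail_barrier_ge by lia.
      assert (E : hstep x i = H) by (apply Hc; lia); unfold hstep in E.
      replace (x i - x J) with (x (i - 1)%nat - x J + H) by lra; now rewrite layer_add.
Qed.

(** On the fine part (1 - p) (1 - r) is of order (h / eps)^2 and (1 - q) h at most of order h^2 /
    eps, which leaves e / eps. At [J] the backward slope of order e / eps meets b q / (1 - q) <= eps
    / H. *)
Lemma LN_layer_barrier_bounds (beta mu M Y eps h H : R) (b c : R -> R) (x : nat -> R) (N J i : nat) :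
  0 < beta -> 0 < mu -> 0 < M -> 0 < Y -> 0 < eps ->
  (forall y, I01 y -> beta + mu <= b y) -> (forall y, I01 y -> b y <= M) ->
  (forall y, I01 y -> 0 <= c y) ->
  two_step_grid x N J h H -> (1 <= i <= N - 1)%nat -> h <= Y * eps ->
  let E := layer_barrier beta eps x J in
  ((i < J)%nat -> beta * beta * mu * exp (- (beta * Y)) * exp (- (mu * Y)) / M * (E i / eps)
                  <= LN eps b c x E i) /\
  (i = J -> - (2 * beta * exp (beta * Y)) * (layer beta eps (x J) / H) <= LN eps b c x E i) /\
  ((J < i)%nat -> 0 <= LN eps b c x E i).
Proof.
  intros Hbeta Hmu HM HY He Hblo Hbhi Hclo G Hi HhY E.
  pose proof (grid_interior _ _ _ _ _ _ G Hi) as Hx.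
  assert (HI : I01 (x i)) by (unfold I01; lra).
  specialize (Hblo _ HI); specialize (Hclo _ HI); specialize (Hbhi _ HI).
  pose proof (layer_barrier_bounds beta eps h H x N J i Hbeta He G ltac:(lia)) as HE; fold E in HE.
  destruct G as [HJ Hh HhH Hf Hc H0 H1].
  split; [intros Hlt | split; [intros -> | intros Hgt]].
  - assert (E2 : hstep x (S i) = h) by (apply Hf; lia).
    rewrite (LN_layer_barrier eps beta b c x _ i h);
      [ | assumption | lra | lra | apply Hf; lia | exact E2 | | ].
    + pose proof (fitting_bounds eps b x i He ltac:(lra) ltac:(lra)) as Hq.
      assert (Hq1 : 1 - fitting eps b x i <= M * (h / eps)).
      { unfold fitting; rewrite E2; pose proof (exp_ineq1_le (- (b (x i) * h / eps))).
        assert (b (x i) * h / eps <= M * h / eps).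
        { apply Rmult_le_compat_r; [left; now apply Rinv_0_lt_compat | nra]. }
        unfold Rdiv in *; lra. }
      set (q := fitting eps b x i) in *.
      set (y := h / eps) in *.
      assert (Hy : 0 < y) by (apply Rdiv_lt_0_compat; lra).
      assert (HyY : y <= Y).
      { apply (Rmult_le_reg_r eps); [lra |]; unfold y; replace (h / eps * eps) with h by (field; lra); lra. }
      assert (Eh : h = y * eps) by (unfold y; field; lra).
      replace (beta * h / eps) with (beta * y) by (unfold y; field; lra).
      replace ((b (x i) - beta) * h / eps) with ((b (x i) - beta) * y) by (unfold y; field; lra).
      clearbody y.
      assert (L1 : exp (- (beta * Y)) * (beta * y) <= 1 - exp (- (beta * y)))
        by (apply exp_neg_lower; nra).
      assert (L2 : exp (- (mu * Y)) * (mu * y) <= 1 - exp (- ((b (x i) - beta) * y))).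
      { apply Rle_trans with (1 - exp (- (mu * y))); [apply exp_neg_lower; nra |].
        assert (exp (- ((b (x i) - beta) * y)) <= exp (- (mu * y))) by (apply exp_le; nra); lra. }
      pose proof (exp_pos (- (beta * Y))) as P1; pose proof (exp_pos (- (mu * Y))) as P2.
      set (p1 := exp (- (beta * Y))) in *; set (p2 := exp (- (mu * Y))) in *.
      (* The upper bound on 1 - q becomes a lower bound on the prefactor. *)
      assert (L3 : beta / (M * y * h) <= b (x i) / ((1 - q) * h)).
      { apply Rmult_le_compat; [lra | left; apply Rinv_0_lt_compat; repeat apply Rmult_lt_0_compat; lra | lra |].
        apply Rinv_le_contravar; [apply Rmult_lt_0_compat; lra | apply Rmult_le_compat_r; lra]. }
      assert (Pq : 0 < beta / (M * y * h))
        by (apply Rdiv_lt_0_compat; [lra | repeat apply Rmult_lt_0_compat; lra]).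
      replace (beta * beta * mu * p1 * p2 / M * (E i / eps)) with
        (beta / (M * y * h) * (p1 * (beta * y)) * (p2 * (mu * y)) * E i) by (rewrite Eh; field; lra).
      apply Rle_trans with (b (x i) / ((1 - q) * h) * (1 - exp (- (beta * y)))
        * (1 - exp (- ((b (x i) - beta) * y))) * E i); [| assert (0 <= c (x i) * E i) by nra; lra].
      assert (0 < p1 * (beta * y)) by (repeat apply Rmult_lt_0_compat; lra).
      assert (0 < p2 * (mu * y)) by (repeat apply Rmult_lt_0_compat; lra).
      apply Rmult_le_compat_r; [lra |].
      apply Rmult_le_compat; [apply Rmult_le_pos; lra | lra | | exact L2].
      apply Rmult_le_compat; lra.
    + unfold E; rewrite !layer_barrier_le, (hstep_succ x), E2 by lia; apply layer_add.
    + unfold E; rewrite !layer_barrier_le by lia.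
      assert (E1 : hstep x i = h) by (apply Hf; lia); unfold hstep in E1.
      replace (x i) with (x (i - 1)%nat + h) by lra; apply layer_add.
  - assert (E1 : hstep x J = h) by (apply Hf; lia).
    assert (E2 : hstep x (S J) = H) by (apply Hc; lia).
    rewrite LN_fitting by lra; cbv zeta.
    pose proof (fitting_bounds eps b x J He ltac:(lra) ltac:(lra)) as Hq.
    destruct (fitting_ratio_bounds (b (x J)) H eps ltac:(lra) ltac:(lra) He) as [F1 _].
    cbv zeta in F1; rewrite <- E2 in F1 at 1 2.
    change (exp (- (b (x J) * hstep x (S J) / eps))) with (fitting eps b x J) in F1.
    unfold Defs.Dminus, Defs.Dplus, hbar; rewrite E1, E2.
    unfold E in *; rewrite (layer_barrier_ge _ _ _ _ (S J)) by lia.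
    rewrite (layer_barrier_le _ _ _ _ J) in * by lia.
    rewrite (layer_barrier_le _ _ _ _ (J - 1)) by lia.
    set (q := fitting eps b x J) in *.
    set (e := layer beta eps (x J)) in *.
    assert (Hk : 0 < H / ((h + H) / 2) <= 2).
    { split; [apply Rdiv_lt_0_compat; lra |].
      apply (Rmult_le_reg_r ((h + H) / 2)); [lra |].
      replace (H / ((h + H) / 2) * ((h + H) / 2)) with H by (field; lra); lra. }
    set (k := H / ((h + H) / 2)) in *.
    assert (Ee : e = layer beta eps (x (J - 1)%nat) * exp (- (beta * h / eps))).
    { unfold e; unfold hstep in E1; replace (x J) with (x (J - 1)%nat + h) by lra; apply layer_add. }
    assert (Hm : layer beta eps (x (J - 1)%nat) <= exp (beta * Y) * e).
    { unfold e; apply layer_nearby with h; unfold hstep in E1; lra. }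
    pose proof (layer_pos beta eps (x (J - 1)%nat)) as Pm.
    set (em := layer beta eps (x (J - 1)%nat)) in *.
    assert (Hd : (em - e) / h <= beta / eps * (exp (beta * Y) * e)).
    { pose proof (exp_ineq1_le (- (beta * h / eps))).
      assert (Hbe : 0 < beta / eps) by (apply Rdiv_lt_0_compat; lra).
      apply Rle_trans with (beta / eps * em); [| apply Rmult_le_compat_l; lra].
      apply (Rmult_le_reg_r h); [lra |].
      replace ((em - e) / h * h) with (em - e) by (field; lra).
      replace (beta / eps * em * h) with (em * (beta * h / eps)) by (field; lra).
      rewrite Ee; nra. }
    assert (Hd0 : 0 <= (em - e) / h).
    { apply Rmult_le_pos; [| left; apply Rinv_0_lt_compat; lra].
      pose proof (exp_neg_le_1 (beta * h / eps)
        ltac:(apply Rmult_le_pos; [nra | left; now apply Rinv_0_lt_compat])).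
      rewrite Ee; nra. }
    replace (b (x J) / (1 - q) * (k * q * ((e - em) / h) - (k * q + (1 - q)) * ((e - e) / H)) + c (x J) * e)
      with (c (x J) * e - k * (b (x J) * q / (1 - q) * ((em - e) / h))) by (field; lra).
    assert (0 <= c (x J) * e) by nra.
    assert (Hr : 0 < b (x J) * q / (1 - q)) by (apply Rdiv_lt_0_compat; nra).
    enough (k * (b (x J) * q / (1 - q) * ((em - e) / h)) <= 2 * (eps / H * (beta / eps * (exp (beta * Y) * e)))).
    { replace (- (2 * beta * exp (beta * Y)) * (e / H)) with
        (- (2 * (eps / H * (beta / eps * (exp (beta * Y) * e))))) by (field; lra). lra. }
    apply Rmult_le_compat; [lra | apply Rmult_le_pos; lra | lra |].
    apply Rmult_le_compat; lra.
  - rewrite LN_constant by (unfold E; rewrite !layer_barrier_ge by lia; reflexivity).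
    apply Rmult_le_pos; lra.
Qed.

(** * The error bound *)

(** [delta] plays the part of 1 / N. With m = eps delta + e (x_J), the error is compared with m K1
    (1 - x) + m K2 B + K3 eps delta E, where [B] is the tail barrier and [E] the layer barrier. *)
Lemma grid_error (beta mu M Y Z : R) :
  0 < beta -> 0 < mu -> 0 < M -> 0 < Y -> 0 < Z ->
  exists C, 0 < C /\
  forall (eps h H delta : R) (b b1 b2 c c1 c2 w g g2 v2 : R -> R) (x W : nat -> R) (N J : nat),
    layer_problem beta mu M eps b b1 b2 c c1 c2 w g g2 v2 ->
    two_step_grid x N J h H ->
    0 < delta <= 1 -> h <= Y * eps -> H <= Z * delta -> (h / eps) ^ 2 <= Z * delta ->
    W 0%nat = w 0 -> W N = 0 ->
    (forall i, (1 <= i <= N - 1)%nat -> LN eps b c x W i = eps * v2 (x i)) ->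
    forall i, (i <= N)%nat ->
      Rabs (w (x i) - W i) <= C * (eps * delta + layer beta eps (x J)).
Proof.
  intros Hbeta Hmu HM HY HZ.
  destruct (layer_problem_bounds beta mu M Hbeta Hmu HM) as [K [HK HB]].
  assert (PMK : 0 < M * K) by nra.
  assert (Pib : 0 < / beta) by (now apply Rinv_0_lt_compat).
  assert (Pim : 0 < / mu) by (now apply Rinv_0_lt_compat).
  pose proof (exp_pos (beta * Y)) as PL.
  set (CA := 6 * (M * K) + 2 * M + M * K * (4 + / beta + / mu)).
  assert (HCA : 0 < CA).
  { assert (0 < M * K * (4 + / beta + / mu)) by (apply Rmult_lt_0_compat; lra); unfold CA; lra. }
  set (CB := (3 * M * M * K + 12 * (M * K)) * Y + 2 * M + 3 * M * M * K + 12 * (M * K) * exp (beta * Y)).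
  assert (HCB : 0 < CB).
  { assert (0 < M * M * K) by nra.
    assert (0 < (3 * M * M * K + 12 * (M * K)) * Y) by (apply Rmult_lt_0_compat; lra).
    assert (0 < 12 * (M * K) * exp (beta * Y)) by (apply Rmult_lt_0_compat; lra); unfold CB; lra. }
  set (CJ := 4 * K + 16 * K * exp (beta * Y) / beta + 2 * M * K + M).
  assert (HCJ : 0 < CJ).
  { assert (0 < 16 * K * exp (beta * Y) / beta)
      by (apply Rdiv_lt_0_compat; [repeat apply Rmult_lt_0_compat; lra | lra]); unfold CJ; lra. }
  set (k1 := beta * beta * mu * exp (- (beta * Y)) * exp (- (mu * Y)) / M).
  assert (Hk1 : 0 < k1).
  { apply Rdiv_lt_0_compat; [| lra].
    repeat apply Rmult_lt_0_compat; try lra; apply exp_pos. }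
  set (CE := 2 * beta * exp (beta * Y)).
  assert (HCE : 0 < CE) by (unfold CE; nra).
  (* Chosen so that K3 (eps delta) (k1 e / eps) equals the fine layer error CB Z delta e. *)
  set (K3 := CB * Z / k1).
  assert (HK3 : 0 < K3) by (apply Rdiv_lt_0_compat; nra).
  assert (EK3 : K3 * k1 = CB * Z) by (unfold K3; field; lra).
  (* At [J] the tail barrier pays for the truncation error, constant [CJ], and for the negative kink
     of the layer barrier, constant [K3 * CE]. *)
  set (K2 := (CJ + K3 * CE) * (1 + Z) * (2 / beta)).
  assert (HK2 : 0 < K2).
  { assert (0 < 2 / beta) by (apply Rdiv_lt_0_compat; lra).
    assert (0 < K3 * CE) by nra.
    unfold K2; repeat apply Rmult_lt_0_compat; lra. }
  assert (EK2 : K2 * (beta / 2) = (CJ + K3 * CE) * (1 + Z)) by (unfold K2; field; lra).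
  (* The linear barrier takes the remaining errors of order m on both uniform parts, with slack for
     the strict comparison. *)
  set (K1 := (CB * Z + CA * (Z + 1) + 1) / beta).
  assert (HK1 : 0 < K1) by (apply Rdiv_lt_0_compat; nra).
  assert (EK1 : K1 * beta = CB * Z + CA * (Z + 1) + 1) by (unfold K1; field; lra).
  clearbody K1 K2 K3.
  exists (K1 + K2 + K3); split; [lra |].
  intros eps h H delta b b1 b2 c c1 c2 w g g2 v2 x W N J LP G Hdelta HhY HHZ Hh2 HW0 HWN HWL.
  pose proof (HB _ _ _ _ _ _ _ _ _ _ _ LP) as LB.
  pose proof (lp_eps _ _ _ _ _ _ _ _ _ _ _ _ _ _ LP) as [He0 He1].
  pose proof (lp_b_lower _ _ _ _ _ _ _ _ _ _ _ _ _ _ LP) as Hblo.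
  pose proof (lp_c_lower _ _ _ _ _ _ _ _ _ _ _ _ _ _ LP) as Hclo.
  assert (Hbhi : forall y, I01 y -> b y <= M).
  { intros y Hy; pose proof (C2_bound0 _ _ _ _ (lp_b _ _ _ _ _ _ _ _ _ _ _ _ _ _ LP) y Hy) as B.
    apply Rabs_le_between in B; lra. }
  pose proof (layer_pos beta eps (x J)) as HeJ.
  set (eJ := layer beta eps (x J)) in *.
  assert (Hed : 0 < eps * delta) by nra.
  set (m := eps * delta + eJ).
  assert (Hm : 0 < m) by (unfold m; lra).
  set (B := tail_barrier beta eps x J).
  set (E := layer_barrier beta eps x J).
  pose proof (tg_J _ _ _ _ _ G) as HJ.
  pose proof (tg_h _ _ _ _ _ G) as Hh0.
  pose proof (tg_hH _ _ _ _ _ G) as HhH.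
  assert (Htau : forall i, (1 <= i <= N - 1)%nat ->
    Rabs (LN eps b c x (fun j => w (x j)) i - eps * v2 (x i)) <
      m * K1 * beta + m * K2 * LN eps b c x B i + K3 * (eps * delta) * LN eps b c x E i).
  { intros i Hi.
    pose proof (grid_interior _ _ _ _ _ _ G Hi) as Hx.
    destruct (LN_tail_barrier beta mu M eps h H b c x N J i Hbeta Hmu He0 Hblo Hclo G Hi) as [B1 B2].
    destruct (LN_layer_barrier_bounds beta mu M Y eps h H b c x N J i Hbeta Hmu HM HY He0 Hblo Hbhi
      Hclo G Hi HhY) as [E1 [E2 E3]].
    fold B in B1, B2; fold E in E1, E2, E3; fold k1 in E1; fold CE eJ in E2.
    assert (HmK1 : m * K1 * beta = m * (CB * Z + CA * (Z + 1) + 1)) by (rewrite <- EK1; ring).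
    rewrite HmK1.
    assert (HB' : 0 <= m * K2 * LN eps b c x B i) by (repeat apply Rmult_le_pos; lra).
    assert (HmCB : 0 < m * (CB * Z)) by (repeat apply Rmult_lt_0_compat; lra).
    assert (HmCA : 0 < m * (CA * (Z + 1))) by (repeat apply Rmult_lt_0_compat; lra).
    destruct (Nat.lt_trichotomy i J) as [Hlt | [-> | Hgt]].
    - specialize (E1 Hlt).
      assert (S1 : hstep x i = h) by (apply (tg_fine _ _ _ _ _ G); lia).
      assert (S2 : hstep x (S i) = h) by (apply (tg_fine _ _ _ _ _ G); lia).
      assert (X1 : 0 <= x i - h).
      { pose proof (grid_mono x N J h H 0 (i - 1) G ltac:(lia)) as X.
        rewrite (tg_0 _ _ _ _ _ G) in X; unfold hstep in S1; lra. }
      assert (X2 : x i + h <= 1).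
      { pose proof (grid_mono x N J h H (S i) N G ltac:(lia)) as X.
        rewrite (tg_1 _ _ _ _ _ G), (hstep_succ x), S2 in X; lra. }
      assert (EE : E i = layer beta eps (x i)) by (apply layer_barrier_le; lia).
      pose proof (layer_pos beta eps (x i)) as Pe; rewrite EE in E1.
      set (e := layer beta eps (x i)) in *.
      assert (HT : Rabs (LN eps b c x (fun j => w (x j)) i - eps * v2 (x i))
        <= CB * (eps * h + (h / eps) ^ 2 * e)).
      { apply (truncation_uniform beta mu M eps _ h b b1 b2 c c1 c2 w g g2 v2 x i); auto; try lia.
        - apply Rmult_le_pos; [lra |]; apply Rplus_le_le_0_compat; [nra |].
          apply Rmult_le_pos; [apply pow2_ge_0 | lra].
        - intros t Ht; apply (paired_residual_bound_fine beta mu M K Y eps h t b b1 b2 c c1 c2 w g g2 v2); auto. }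
      apply Rle_lt_trans with (1 := HT).
      assert (A1 : CB * (eps * h + (h / eps) ^ 2 * e) <= CB * (Z * (eps * delta) + Z * delta * e)).
      { apply Rmult_le_compat_l; [lra |]; apply Rplus_le_compat.
        - assert (h <= Z * delta) by lra. nra.
        - apply Rmult_le_compat_r; lra. }
      assert (A2 : K3 * (eps * delta) * (k1 * (e / eps)) <= K3 * (eps * delta) * LN eps b c x E i).
      { apply Rmult_le_compat_l; [nra | exact E1]. }
      replace (K3 * (eps * delta) * (k1 * (e / eps))) with (K3 * k1 * delta * e) in A2 by (field; lra).
      rewrite EK3 in A2.
      assert (A3 : CB * Z * (eps * delta) <= CB * Z * m).
      { apply Rmult_le_compat_l; [nra | unfold m; lra]. }
      lra.
    - specialize (E2 eq_refl); specialize (B2 eq_refl).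
      assert (HT : Rabs (LN eps b c x (fun j => w (x j)) J - eps * v2 (x J)) <= CJ * (eps + eJ / H)).
      { now apply (truncation_transition beta mu M K Y eps h H b b1 b2 c c1 c2 w g g2 v2 x N J). }
      apply Rle_lt_trans with (1 := HT).
      assert (HH : 0 < H) by lra.
      assert (PeH : 0 < eJ / H) by (apply Rdiv_lt_0_compat; lra).
      (* H <= Z delta exchanges the full eps of the transition error for eps delta / H, the scale on
         which the tail barrier acts. *)
      assert (A0 : eps <= Z * (eps * delta / H)).
      { apply (Rmult_le_reg_r H); [lra |].
        replace (Z * (eps * delta / H) * H) with (eps * (Z * delta)) by (field; lra).
        apply Rmult_le_compat_l; lra. }
      assert (P0 : 0 < eps * delta / H) by (apply Rdiv_lt_0_compat; lra).
      assert (A1 : (CJ + K3 * CE) * (eps + eJ / H) <= m * K2 * LN eps b c x B J).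
      { apply Rle_trans with (m * K2 * (beta / 2 / H)); [| apply Rmult_le_compat_l; [nra | lra]].
        replace (m * K2 * (beta / 2 / H)) with (K2 * (beta / 2) * (m / H)) by (field; lra).
        rewrite EK2, Rmult_assoc; apply Rmult_le_compat_l; [nra |].
        unfold m; replace ((eps * delta + eJ) / H) with (eps * delta / H + eJ / H) by (field; lra).
        assert (0 < Z * (eJ / H)) by nra. lra. }
      assert (A2 : - (K3 * CE * (eJ / H)) <= K3 * (eps * delta) * LN eps b c x E J).
      { apply Rle_trans with (K3 * (eps * delta) * (- CE * (eJ / H))); [| apply Rmult_le_compat_l; [nra | lra]].
        assert (P1 : 0 < K3 * CE * (eJ / H)) by (apply Rmult_lt_0_compat; [now apply Rmult_lt_0_compat | lra]).
        assert (eps * delta <= 1) by nra.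
        replace (K3 * (eps * delta) * (- CE * (eJ / H))) with
          (- ((eps * delta) * (K3 * CE * (eJ / H)))) by ring.
        nra. }
      assert (A3 : 0 < K3 * CE * eps) by (apply Rmult_lt_0_compat; [now apply Rmult_lt_0_compat | lra]).
      lra.
    - specialize (E3 Hgt).
      assert (S1 : hstep x i = H) by (apply (tg_coarse _ _ _ _ _ G); lia).
      assert (S2 : hstep x (S i) = H) by (apply (tg_coarse _ _ _ _ _ G); lia).
      assert (X1 : 0 <= x i - H).
      { pose proof (grid_mono x N J h H 0 (i - 1) G ltac:(lia)) as X.
        rewrite (tg_0 _ _ _ _ _ G) in X; unfold hstep in S1; lra. }
      assert (X2 : x i + H <= 1).
      { pose proof (grid_mono x N J h H (S i) N G ltac:(lia)) as X.
        rewrite (tg_1 _ _ _ _ _ G), (hstep_succ x), S2 in X; lra. }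
      assert (He : layer beta eps (x i) <= eJ).
      { apply layer_antitone; auto; apply (grid_mono x N J h H); [exact G | lia]. }
      pose proof (layer_pos beta eps (x i)) as Pe.
      assert (HT : Rabs (LN eps b c x (fun j => w (x j)) i - eps * v2 (x i))
        <= CA * (eps * H + layer beta eps (x i))).
      { apply (truncation_uniform beta mu M eps _ H b b1 b2 c c1 c2 w g g2 v2 x i); auto; try lia; try lra.
        - apply Rmult_le_pos; [lra |]; nra.
        - intros t Ht; apply (paired_residual_bound beta mu M K eps H t b b1 b2 c c1 c2 w g g2 v2); auto. }
      apply Rle_lt_trans with (1 := HT).
      assert (A1 : CA * (eps * H + layer beta eps (x i)) <= CA * ((Z + 1) * m)).
      { apply Rmult_le_compat_l; [lra |]; unfold m.
        assert (eps * H <= Z * (eps * delta)) by nra.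
        assert (0 < Z * eJ) by nra. lra. }
      assert (A2 : 0 <= K3 * (eps * delta) * LN eps b c x E i) by (apply Rmult_le_pos; [nra | lra]).
      lra. }
  (* The factors 1 and -1 keep the expression in the syntactic shape that [LN_linear] rewrites. *)
  assert (Hdom : forall s, s = 1 \/ s = -1 -> forall i, (i <= N)%nat ->
    0 <= 1 * ((m * K1) * (1 - x i) + 1 * ((m * K2) * B i + (K3 * (eps * delta)) * E i))
         + s * (1 * w (x i) + -1 * W i)).
  { intros s Hs.
    assert (Hnn : forall i, (i <= N)%nat ->
      0 <= 1 * ((m * K1) * (1 - x i) + 1 * ((m * K2) * B i + (K3 * (eps * delta)) * E i))).
    { intros i Hi.
      pose proof (grid_mono x N J h H i N G ltac:(lia)) as X; rewrite (tg_1 _ _ _ _ _ G) in X.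
      pose proof (tail_barrier_bounds beta eps h H x N J i Hbeta He0 G Hi) as PB; fold B in PB.
      pose proof (layer_barrier_bounds beta eps h H x N J i Hbeta He0 G Hi) as PE; fold E in PE.
      rewrite !Rmult_1_l.
      repeat apply Rplus_le_le_0_compat; apply Rmult_le_pos; nra. }
    apply (discrete_comparison eps b c x _ N He0).
    - intros i Hi; apply (grid_step x N J h H i G Hi).
    - intros i Hi; pose proof (grid_interior _ _ _ _ _ _ G Hi) as Hx.
      assert (HI : I01 (x i)) by (unfold I01; lra).
      specialize (Hblo _ HI); specialize (Hclo _ HI); lra.
    - intros i Hi; pose proof (grid_interior _ _ _ _ _ _ G Hi) as Hx.
      assert (HI : I01 (x i)) by (unfold I01; lra).
      rewrite (LN_linear eps b c x (fun j => (m * K1) * (1 - x j) + 1 * ((m * K2) * B j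
        + (K3 * (eps * delta)) * E j)) (fun j => 1 * w (x j) + -1 * W j) 1 s i).
      rewrite (LN_linear eps b c x (fun j => 1 - x j) (fun j => (m * K2) * B j
        + (K3 * (eps * delta)) * E j)).
      rewrite (LN_linear eps b c x B E), (LN_linear eps b c x (fun j => w (x j)) W).
      rewrite (HWL i Hi).
      specialize (Htau i Hi).
      pose proof (sign_mul_bounds s _ _ Hs (Rle_refl
        (Rabs (LN eps b c x (fun j => w (x j)) i - eps * v2 (x i))))) as HS.
      specialize (Hblo _ HI); specialize (Hclo _ HI).
      rewrite LN_linear_barrier; [| assumption | lra | |].
      + assert (m * K1 * beta <= m * K1 * (b (x i) + c (x i) * (1 - x i))).
        { apply Rmult_le_compat_l; [nra |]. assert (0 <= c (x i) * (1 - x i)) by nra. lra. }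
        lra.
      + apply (grid_step x N J h H i G); lia.
      + apply (grid_step x N J h H (S i) G); lia.
    - rewrite (tg_0 _ _ _ _ _ G), HW0; specialize (Hnn 0%nat ltac:(lia)).
      rewrite (tg_0 _ _ _ _ _ G) in Hnn; lra.
    - rewrite (tg_1 _ _ _ _ _ G), HWN, (lp_w1 _ _ _ _ _ _ _ _ _ _ _ _ _ _ LP).
      specialize (Hnn N ltac:(lia)); rewrite (tg_1 _ _ _ _ _ G) in Hnn; lra. }
  intros i Hi.
  pose proof (Hdom 1 (or_introl eq_refl) i Hi) as D1.
  pose proof (Hdom (-1) (or_intror eq_refl) i Hi) as D2.
  pose proof (grid_mono x N J h H 0 i G ltac:(lia)) as X; rewrite (tg_0 _ _ _ _ _ G) in X.
  pose proof (tail_barrier_bounds beta eps h H x N J i Hbeta He0 G Hi) as PB; fold B in PB.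
  pose proof (layer_barrier_bounds beta eps h H x N J i Hbeta He0 G Hi) as PE; fold E in PE.
  fold m.
  assert (m * K1 * (1 - x i) <= m * K1) by (assert (0 < m * K1) by nra; nra).
  assert (m * K2 * B i <= m * K2) by (assert (0 < m * K2) by nra; nra).
  assert (K3 * (eps * delta) * E i <= K3 * m).
  { apply Rle_trans with (K3 * (eps * delta) * 1).
    - apply Rmult_le_compat_l; [nra | lra].
    - rewrite Rmult_1_r; apply Rmult_le_compat_l; [lra | unfold m; lra]. }
  apply Rabs_le; split; lra.
Qed.

(** * Logarithm estimates, the Shishkin mesh and assembly of the bound *)

Lemma ln_le_self (n : R) : 1 <= n -> 0 <= ln n <= n.
Proof.
  intros Hn; split.
  - rewrite <- ln_1; destruct Hn as [Hn | <-]; [left; apply ln_increasing; lra | lra].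
  - pose proof (exp_ineq1_le (ln n)); rewrite exp_ln in *; lra.
Qed.

(** Apply ln s <= s to s = sqrt n. This is what makes (h / eps)^2, of order (ln N / N)^2, at most of
    order 1 / N. *)
Lemma ln_sqr_le (n : R) : 1 <= n -> ln n ^ 2 <= 4 * n.
Proof.
  intros Hn.
  assert (Hs : 1 <= sqrt n) by (rewrite <- sqrt_1; apply sqrt_le_1; lra).
  pose proof (ln_le_self (sqrt n) Hs) as [L0 L1].
  assert (E : ln n = 2 * ln (sqrt n)).
  { rewrite <- (sqrt_sqrt n) at 1 by lra; rewrite ln_mult by lra; ring. }
  rewrite E; assert (n = sqrt n * sqrt n) by (symmetry; apply sqrt_sqrt; lra).
  nra.
Qed.

Lemma shishkin_two_step_grid (xi Q : R) (N J : nat) :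
  0 < Q < 1 -> 0 < xi <= Q -> (0 < N)%nat -> INR J = Q * INR N ->
  two_step_grid (mesh xi N J) N J (xi / INR J) ((1 - xi) / (INR N - INR J)).
Proof.
  intros HQ Hxi HN HJ.
  assert (Hn : 0 < INR N) by (now apply lt_0_INR).
  assert (HJ0 : 0 < INR J) by (rewrite HJ; nra).
  assert (HJN : INR J < INR N) by (rewrite HJ; nra).
  assert (HJ1 : (1 <= J < N)%nat).
  { split; [| now apply INR_lt].
    destruct J; [simpl in HJ0; lra | lia]. }
  assert (Hge : forall i, (J <= i)%nat ->
    mesh xi N J i = xi + (INR i - INR J) * ((1 - xi) / (INR N - INR J))).
  { intros i Hi; unfold mesh; destruct (Nat.leb_spec i J); [| reflexivity].
    replace i with J by lia; field; lra. }
  assert (Hle : forall i, (i <= J)%nat -> mesh xi N J i = INR i * (xi / INR J)).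
  { intros i Hi; unfold mesh; apply Nat.leb_le in Hi; now rewrite Hi. }
  split.
  - exact HJ1.
  - apply Rdiv_lt_0_compat; lra.
  (* After clearing denominators, h <= H reads xi (1 - Q) <= (1 - xi) Q, that is xi <= Q. *)
  - rewrite HJ.
    apply (Rmult_le_reg_r (Q * (1 - Q) * INR N)); [nra |].
    replace (xi / (Q * INR N) * (Q * (1 - Q) * INR N)) with (xi * (1 - Q)) by (field; lra).
    replace ((1 - xi) / (INR N - Q * INR N) * (Q * (1 - Q) * INR N)) with ((1 - xi) * Q)
      by (field; nra).
    nra.
  - intros i Hi; unfold hstep; rewrite !Hle by lia.
    rewrite minus_INR by lia; simpl; ring.
  - intros i Hi; unfold hstep; rewrite !Hge by lia.
    rewrite minus_INR by lia; simpl; ring.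
  - rewrite Hle by lia; simpl; ring.
  - rewrite Hge by lia; field; lra.
Qed.

Theorem theorem4 :
  forall (b c f : R -> R) (beta Q a : R),
    Ck01 4 b -> Ck01 4 c -> Ck01 4 f ->
    0 < beta ->
    (forall x, I01 x -> beta < b x) ->
    (forall x, I01 x -> 0 <= c x) ->
    0 < Q < 1 ->
    (exists p q : Z, IZR q <> 0 /\ Q = IZR p / IZR q) ->
    0 < a ->
    a >= Rmin 3 (Rmax 1 (beta / (b 0 - beta))) ->
    exists C : R,
      forall (eps : R) (N J : nat) (u u0 : R -> R) (WN : nat -> R),
        0 < eps < 1 ->
        (0 < N)%nat ->
        INR J = Q * INR N ->
        xi_tr a eps beta (INR N) <= Q ->
        (* u solves -eps u'' - b u' + c u = f on (0,1), u(0) = u(1) = 0 *)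
        cont01 u ->
        (forall x, 0 < x < 1 ->
           ex_derive u x /\ ex_derive (Derive u) x /\
           - eps * Derive (Derive u) x - b x * Derive u x + c x * u x = f x) ->
        u 0 = 0 -> u 1 = 0 ->
        (* u0 solves -b u0' + c u0 = f on (0,1), u0(1) = 0 *)
        cont01 u0 ->
        (forall x, 0 < x < 1 ->
           ex_derive u0 x /\ - b x * Derive u0 x + c x * u0 x = f x) ->
        u0 1 = 0 ->
        (* the discrete solution W^N on S_N *)
        let x := mesh (xi_tr a eps beta (INR N)) N J in
        WN 0%nat = - u0 0 ->
        (forall i, (1 <= i <= N - 1)%nat ->
           LN eps b c x WN i = eps * Derive (Derive u0) (x i)) ->
        WN N = 0 ->
        (* || w^N - W^N || <= C max{...}, with w = u - u0 *)
        forall i, (i <= N)%nat ->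
          Rabs ((u (x i) - u0 (x i)) - WN i) <=
          C * Rmax (eps * / (INR N ^ 2) * (ln (INR N)) ^ 2)
                   (eps * / INR N + Rpower (INR N) (- (a + 1) / 2)).
Proof.
  intros b c f beta Q a Hb Hc Hf Hbeta Hblo Hclo HQ _ Ha0 Ha.
  assert (Ha1 : 1 <= a).
  { apply Rge_le in Ha; apply Rle_trans with (2 := Ha).
    apply Rmin_glb; [lra | apply Rmax_l]. }
  destruct (Ck01_C2 b Hb) as [Cb [b1 [b2 [Mb [PMb Bb]]]]].
  destruct (Ck01_C2 c Hc) as [_ [c1 [c2 [Mc [PMc Bc]]]]].
  destruct (Ck01_C2 f Hf) as [_ [f1 [f2 [Mf [PMf Bf]]]]].
  destruct (cont01_gap b beta Cb Hblo) as [mu [Hmu Hgap]].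
  destruct (reduced_solution_bounds beta (Mb + Mc + Mf) Hbeta ltac:(lra)) as [Kr [HKr Hred]].
  set (M := Mb + Mc + Mf + Kr).
  (* Here h / eps = Y ln N / N, and ln N <= N. *)
  set (Y := a / (beta * Q)).
  assert (HY : 0 < Y) by (apply Rdiv_lt_0_compat; nra).
  assert (HZ1 : 0 < / (1 - Q)) by (apply Rinv_0_lt_compat; lra).
  (* In this value of [Z], 4 Y^2 covers (h / eps)^2 through [ln_sqr_le], and 1 / (1 - Q) covers N H
     = (1 - xi) / (1 - Q). *)
  assert (HZ : 0 < 4 * Y ^ 2 + / (1 - Q)) by (pose proof (pow2_ge_0 Y); lra).
  destruct (grid_error beta mu M Y (4 * Y ^ 2 + / (1 - Q)) Hbeta Hmu ltac:(unfold M; lra) HY HZ)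
    as [C [HC Hgrid]].
  exists C; intros eps N J u u0 WN Heps HN HJ Hxi Cu Hu Hu0 Hu1 Cu0 Hu0' Hu01 x HW0 HWL HWN.
  set (n := INR N) in *.
  assert (Hn0 : 0 < n) by (now apply lt_0_INR).
  (* J = Q N with 0 < Q < 1 forces 1 <= J < N; then ln N > 0, and the fine steps have positive
     length. *)
  assert (Hn2 : 2 <= n).
  { assert (HJ1 : (1 <= J)%nat).
    { destruct J; [simpl in HJ; nra | lia]. }
    assert (HJN : (J < N)%nat) by (apply INR_lt; fold n; rewrite HJ; nra).
    assert (HN2 : (2 <= N)%nat) by lia.
    apply le_INR in HN2; exact HN2. }
  assert (Hln : 0 < ln n) by (rewrite <- ln_1; apply ln_increasing; lra).
  destruct (ln_le_self n ltac:(lra)) as [_ Hlnn].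
  set (xi := xi_tr a eps beta n) in *.
  assert (Hxi0 : 0 < xi).
  { unfold xi, xi_tr; apply Rmult_lt_0_compat; [apply Rdiv_lt_0_compat; nra | assumption]. }
  assert (HJn : INR J = Q * n) by exact HJ.
  assert (HJ0 : 0 < INR J) by (rewrite HJn; nra).
  pose proof (shishkin_two_step_grid xi Q N J HQ (conj Hxi0 Hxi) HN HJ) as G; fold n x in G.
  set (u0c := fun y => u0 (clamp01 y)).
  assert (Ecl : forall y, 0 <= y <= 1 -> u0c y = u0 y).
  { intros y Hy; unfold u0c; now rewrite clamp01_id. }
  assert (Du0 : forall y, 0 < y < 1 -> is_derive u0 y ((c y * u0c y - f y) / b y)).
  { intros y Hy; destruct (Hu0' y Hy) as [Ex Eq].
    specialize (Hblo y ltac:(unfold I01; lra)).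
    apply Derive_correct in Ex; rewrite Ecl by lra.
    replace ((c y * u0 y - f y) / b y) with (Derive u0 y); [assumption |].
    rewrite <- Eq; field; lra. }
  destruct (Hred b b1 b2 c c1 c2 f f1 f2 u0c) as [Bu00 [v2 [Dv [Bv Lv]]]].
  { apply C2_bounded_mono with Mb; [lra | assumption]. }
  { apply C2_bounded_mono with Mc; [lra | assumption]. }
  { apply C2_bounded_mono with Mf; [lra | assumption]. }
  { intros y Hy; specialize (Hgap y Hy); lra. }
  { assumption. }
  { intros y; now apply continuity_clamp01. }
  { rewrite Ecl by lra; assumption. }
  { intros y Hy; apply (is_derive_clamp01 u0); auto. }
  assert (DDu0 : forall y, 0 < y < 1 -> Derive (Derive u0) y = v2 y).
  { intros y Hy.
    rewrite <- (is_derive_unique _ _ _ (Dv y Hy)).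
    apply Derive_ext_loc.
    assert (Hp : 0 < Rmin y (1 - y)) by (apply Rmin_pos; lra).
    exists (mkposreal _ Hp); intros z Hz; apply is_derive_unique, Du0.
    assert (Hz' : Rabs (z - y) < Rmin y (1 - y)) by exact Hz.
    pose proof (Rmin_l y (1 - y)); pose proof (Rmin_r y (1 - y)).
    apply Rabs_def2 in Hz'; lra. }
  set (w := fun y => u (clamp01 y) - u0c y).
  set (v1 := fun y => (c y * u0c y - f y) / b y) in *.
  assert (LP : layer_problem beta mu M eps b b1 b2 c c1 c2 w (fun y => Derive u y - v1 y)
    (fun y => Derive (Derive u) y - v2 y) v2).
  { split; auto.
    - apply C2_bounded_mono with Mb; [unfold M; lra | assumption].
    - apply C2_bounded_mono with Mc; [unfold M; lra | assumption].
    - intros y; apply continuity_pt_minus; now apply continuity_clamp01.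
    - unfold w; rewrite clamp01_id by (unfold I01; lra); rewrite Hu0, Rminus_0_l, Rabs_Ropp.
      unfold M; lra.
    - unfold w; rewrite clamp01_id by (unfold I01; lra); rewrite Ecl by lra; lra.
    - intros y Hy; destruct (Hu y Hy) as [Ex _]; apply Derive_correct in Ex.
      apply (is_derive_minus (V := R_NormedModule)); apply is_derive_clamp01; auto.
    - intros y Hy; destruct (Hu y Hy) as [_ [Ex _]]; apply Derive_correct in Ex.
      apply (is_derive_minus (V := R_NormedModule)); auto.
    - intros y Hy; destruct (Hu y Hy) as [_ [_ Eq]].
      specialize (Hblo y ltac:(unfold I01; lra)).
      unfold w, v1; rewrite clamp01_id by (unfold I01; lra).
      replace (b y * (Derive u y - (c y * u0c y - f y) / b y)) with
        (b y * Derive u y - (c y * u0c y - f y)) by (field; lra).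
      lra.
    - intros y Hy; specialize (Bv y Hy); unfold M; lra.
    - intros y z Hy Hz; apply Rle_trans with (1 := Lv y z Hy Hz).
      apply Rmult_le_compat_r; [apply Rabs_pos | unfold M; lra]. }
  intros i Hi.
  assert (Hxi1 : 0 <= x i <= 1).
  { rewrite <- (tg_0 _ _ _ _ _ G) at 1; rewrite <- (tg_1 _ _ _ _ _ G).
    split; eapply grid_mono; eauto; lia. }
  assert (Ew : w (x i) = u (x i) - u0 (x i)).
  { unfold w; rewrite clamp01_id, Ecl by assumption; reflexivity. }
  assert (Hhe : xi / INR J / eps = Y * (ln n / n)).
  { unfold xi, xi_tr, Y; rewrite HJn; field; lra. }
  assert (Hlnn1 : ln n / n <= 1).
  { apply (Rmult_le_reg_r n); [lra |]; replace (ln n / n * n) with (ln n) by (field; lra); lra. }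
  assert (Herr : Rabs (w (x i) - WN i) <= C * (eps * / n + layer beta eps (x J))).
  { eapply Hgrid; [exact LP | exact G | | | | | | | |exact Hi].
    - split; [now apply Rinv_0_lt_compat |].
      rewrite <- Rinv_1; apply Rinv_le_contravar; lra.
    - replace (xi / INR J) with (xi / INR J / eps * eps) by (field; lra).
      apply Rmult_le_compat_r; [lra |]; rewrite Hhe; nra.
    - rewrite HJn.
      apply Rle_trans with (/ (1 - Q) * / n).
      + replace ((1 - xi) / (n - Q * n)) with ((1 - xi) * (/ (1 - Q) * / n))
          by (field; repeat split; nra).
        assert (0 < / n) by (now apply Rinv_0_lt_compat).
        assert (0 < / (1 - Q) * / n) by (now apply Rmult_lt_0_compat). nra.
      + apply Rmult_le_compat_r; [left; now apply Rinv_0_lt_compat |].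
        pose proof (pow2_ge_0 Y); lra.
    - rewrite Hhe.
      apply Rle_trans with (4 * Y ^ 2 * / n).
      + replace ((Y * (ln n / n)) ^ 2) with (Y ^ 2 * (ln n ^ 2 * (/ n * / n))) by (field; lra).
        replace (4 * Y ^ 2 * / n) with (Y ^ 2 * (4 * n * (/ n * / n))) by (field; lra).
        apply Rmult_le_compat_l; [apply pow2_ge_0 |].
        apply Rmult_le_compat_r; [| apply ln_sqr_le; lra].
        assert (0 < / n) by (now apply Rinv_0_lt_compat); nra.
      + apply Rmult_le_compat_r; [left; now apply Rinv_0_lt_compat | lra].
    - unfold w; rewrite clamp01_id, Ecl by (unfold I01; lra); rewrite HW0, Hu0; ring.
    - exact HWN.
    - intros j Hj; rewrite (HWL j Hj), DDu0; [reflexivity |].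
      eapply grid_interior; eauto. }
  rewrite <- Ew; apply Rle_trans with (1 := Herr).
  apply Rmult_le_compat_l; [lra |].
  apply Rle_trans with (2 := Rmax_r _ _); apply Rplus_le_compat_l.
  assert (EJ : x J = xi).
  { unfold x, mesh; rewrite Nat.leb_refl; field; lra. }
  rewrite EJ; unfold layer.
  replace (- (beta * xi / eps)) with (- a * ln n) by (unfold xi, xi_tr; field; lra).
  (* [Rpower] unfolds to exp of exponent times ln, so the layer at the transition point is a power
     of N by conversion. *)
  change (Rpower n (- a) <= Rpower n (- (a + 1) / 2)).
  apply Rle_Rpower; lra.
Qed.
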